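(* Let $W=(k'',\beta_u)$, $T$ and the $T$-invariant good lattice $B$ be as in the context, and assume that $B$ is self-dual (i.e. $k''/k'$ is ramified, or $k''/k'$ is unramified and $\mu$ is even). Consider the Weil representation $S^B_\psi$ on $\mathcal{H}^B_\psi$ restricted to $T$. a) The function $\delta_0$ is, up to a multiplicative scalar, the unique vector of trivial weight of $T$. b) Suppose $k''$ is unramified over $k'$. (i) A non-trivial character $\chi$ of $T$ occurs in $S^B_\psi$ if and only if its conductor is even. (ii) Let $\chi$ be a character of $T$ of even conductor $2j>0$. Then there exists $a\in\mathcal{O}''^\times$ such that $$\chi(t)=\psi\bigl(-\tfrac14\mathrm{tr}_{k''/k}(\varpi'^{\mu-2j}aa^\tau u\,t)\bigr)\quad\text{for all }t\in T_j,$$ and the subspace of vectors of weight $\chi$ is spanned by $$\varphi_\chi=\sum_{g\in T/T_j}\chi(g^{-1})\,\delta_{\varpi'^{\frac\mu2-j}ga}.$$ c) Suppose $k''$ is ramified over $k'$. Let $\chi$ be a non-trivial character of $T$. Then $\chi$ occurs in $S^B_\psi$ if and only if its conductor is an even integer $2j$ and there exists $a\in\mathcal{O}''^\times$ such that $$\chi(t)=\psi\bigl(-\tfrac{(-1)^{j-\mu}}4\mathrm{tr}_{k''/k}(\varpi'^{\mu-j}aa^\tau\varpi''t)\bigr)\quad\text{for all }t\in T_j.$$ In that case the subspace of vectors of weight $\chi$ is spanned by $$\varphi_\chi=\sum_{g\in T/T_j}\chi(g^{-1})\,\delta_{\varpi''^{\mu-j}ga}.$$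
   Context: $k$ is a non-archimedean local field of characteristic $0$ with ring of integers $\mathcal{O}$, uniformizer $\varpi$, residue field $\mathbb{F}_q$ of characteristic $p\neq2$; $\psi$ is a non-trivial unitary character of $(k,+)$ with conductor $\lambda_\psi$ (trivial on $\varpi^{\lambda_\psi}\mathcal{O}$, not on $\varpi^{\lambda_\psi-1}\mathcal{O}$). $k'$ is an extension of $k$ of degree $r$, $k''$ a quadratic extension of $k'$, $\tau$ the non-trivial element of $\mathrm{Gal}(k''/k')$. $\mathcal{O}',\mathcal{O}''$ are the rings of integers, $\varpi',\varpi''$ uniformizers and $v',v''$ normalized valuations of $k',k''$, with $\varpi''^2=\varpi'$ if $k''/k'$ is ramified, $\varpi''=\varpi'$ if unramified. $u\in k''^\times$ has trace $0$ over $k'$, with $u=\varpi''$ if $k''/k'$ is ramified and $v''(u)\in\{0,1\}$ if unramified. $W$ is the $k$-space $k''$ with symplectic form $\beta(x,y)=\beta_u(x,y)=\frac12\mathrm{tr}_{k''/k}(u\,x^\tau y)$, and $T=\{t\in k''^\times:tt^\tau=1\}$ acts by multiplication (up to isomorphism every maximal torus of a symplectic group $Sp(W)$ acting irreducibly on $W$ over $k$ is of this form). $e$ is the ramification index of $k'/k$, $\varpi'^\delta\mathcal{O}'$ the different of $k'/k$, and $\mu=e\lambda_\psi-\delta-v''(u)$. $B=\varpi''^\mu\mathcal{O}''$ if $k''/k'$ is ramified, $B=\varpi'^{[(\mu+1)/2]}\mathcal{O}''$ if unramified. The dual of a lattice $L$ is $L^*=\{v\in W:\beta(v,b)\in\varpi^{\lambda_\psi}\mathcal{O}\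 \forall b\in L\}$. When $B$ is self-dual ($B=B^*$), $\mathcal{H}^B_\psi$ is the Hilbert space of functions $\varphi:W\to\mathbb{C}$ with $\varphi(b+w)=\psi(\frac12\beta(w,b))\varphi(w)$ ($b\in B$), $\int_{W/B}|\varphi|^2<\infty$ (lattice model of the Weil representation of $Mp(W)$); the stabilizer $K_B\supset T$ of $B$ in $Sp(W)$ is lifted to $Mp(W)$ so that $S^B_\psi(g)\varphi(w)=\varphi(g^{-1}w)$ for $g\in K_B$, in particular for $g\in T$. For $v\in W$, $\delta_v\in\mathcal{H}^B_\psi$ is the function supported on $v+B$ with $\delta_v(w)=\psi(\frac12\beta(v,w-v))$ for $w\in v+B$. For $j\in\mathbb{N}$, $T_j=\{g\in T:g-1\in\varpi''^j\mathcal{O}''\}$. The conductor of a character $\chi$ of $T$ is the smallest integer $\lambda\ge 0$ with $T_\lambda\subset\ker\chi$. A vector of weight $\chi$ is a vector $\varphi$ with $S^B_\psi(g)\varphi=\chi(g)\varphi$ for $g\in T$; $\chi$ occurs if such $\varphi\neq0$ exists. *)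

(* Defs.v *)
From HB Require Import structures.
From mathcomp Require Import all_boot all_order all_algebra all_field.
From mathcomp Require Import complex.
From mathcomp Require Import boolp classical_sets reals ereal esum.

Set Implicit Arguments.
Unset Strict Implicit.
Unset Printing Implicit Defensive.

Import Order.TTheory GRing.Theory Num.Theory.
Local Open Scope ring_scope.
Local Open Scope classical_set_scope.

(** * Local fields

    A valuation is a function [v : F -> int] of which only the values at
    nonzero elements are meaningful; [v 0] is junk and is never used. *)

Record normalized_valuation (F : fieldType) (v : F -> int) : Prop := {
  valM : forall x y, x != 0 -> y != 0 -> v (x * y) = v x + v y;
  valD : forall x y, x != 0 -> y != 0 -> x + y != 0 ->
           Num.min (v x) (v y) <= v (x + y);
  val_surj : forall n : int, exists2 x, x != 0 & v x = n }.

Definition vge (F : fieldType) (v : F -> int) (n : int) : set F :=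
  [set x | x = 0 \/ n <= v x].

Definition integers (F : fieldType) (v : F -> int) : set F := vge v 0.

Definition int_units (F : fieldType) (v : F -> int) : set F :=
  [set x | x != 0 /\ v x = 0].

Definition uniformizer (F : fieldType) (v : F -> int) (pi : F) : Prop :=
  pi != 0 /\ v pi = 1.

(** The fractional ideal [pi ^ n * O]. *)
Definition pideal (F : fieldType) (v : F -> int) (pi : F) (n : int) : set F :=
  [set pi ^ n * x | x in integers v].

Definition complete_valuation (F : fieldType) (v : F -> int) : Prop :=
  forall s : nat -> F,
    (forall n : int, exists N, forall i j : nat,
        (N <= i)%N -> (N <= j)%N -> vge v n (s i - s j)) ->
    exists l, forall n : int, exists N, forall i : nat,
        (N <= i)%N -> vge v n (s i - l).

(** [res], restricted to [O], is the reduction map onto the residue field. *)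
Record residue_map (F : fieldType) (v : F -> int) (Fq : fieldType)
    (res : F -> Fq) : Prop := {
  res1 : res 1 = 1;
  resD : forall x y, integers v x -> integers v y -> res (x + y) = res x + res y;
  resM : forall x y, integers v x -> integers v y -> res (x * y) = res x * res y;
  res_ker : forall x, integers v x -> (res x = 0 <-> vge v 1 x);
  res_surj : forall z, exists2 x, integers v x & res x = z }.

(** Non-archimedean local field of characteristic 0 with residue field [Fq]. *)
Record local_field0 (k : fieldType) (v : k -> int) (Fq : finFieldType)
    (res : k -> Fq) : Prop := {
  lf_char0 : [pchar k] =i pred0;
  lf_val : normalized_valuation v;
  lf_complete : complete_valuation v;
  lf_res : residue_map v res }.

(** [w] extends [v] along [i : F -> E], with ramification index [e]. *)
Definition extends_valuation (F E : fieldType) (i : F -> E)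
    (v : F -> int) (w : E -> int) (e : nat) : Prop :=
  (0 < e)%N /\ forall x, x != 0 -> w (i x) = e%:Z * v x.

(** Trace of the [k]-linear map "multiplication by [x]", computed in a basis. *)
Definition ext_trace (k : fieldType) (L : fieldExtType k) (x : L) : k :=
  \sum_(i < \dim {:L}) coord (vbasis {:L}) i (x * (vbasis {:L})`_i).

Definition codifferent (k : fieldType) (L : fieldExtType k)
    (v : k -> int) (w : L -> int) : set L :=
  [set x | forall y, integers w y -> integers v (ext_trace (x * y))].

(** The inverse of the fractional ideal [codifferent v w]. *)
Definition different (k : fieldType) (L : fieldExtType k)
    (v : k -> int) (w : L -> int) : set L :=
  [set x | forall y, codifferent v w y -> integers w (x * y)].

(** * Characters *)

Definition continuous_char (R : realType) (F : fieldType) (v : F -> int)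
    (A : set F) (f : F -> R[i]) : Prop :=
  forall x, A x -> forall eps : R[i], 0 < eps ->
    exists n : int, forall y, A y -> vge v n (y - x) -> `|f y - f x| < eps.

Record unitary_add_char (R : realType) (k : fieldType) (v : k -> int)
    (psi : k -> R[i]) : Prop := {
  addcharD : forall x y, psi (x + y) = psi x * psi y;
  addchar_norm : forall x, `|psi x| = 1;
  addchar_cont : continuous_char v setT psi }.

Definition add_conductor (R : realType) (k : fieldType) (v : k -> int) (pi : k)
    (psi : k -> R[i]) (lam : int) : Prop :=
  (forall x, pideal v pi lam x -> psi x = 1) /\
  (exists2 x, pideal v pi (lam - 1) x & psi x != 1).

(** * The torus *)

Definition torus (k : fieldType) (L : fieldExtType k) (tau : 'End(L)) : set L :=
  [set t | t * tau t = 1].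

Definition torus_sub (k : fieldType) (L : fieldExtType k) (tau : 'End(L))
    (w : L -> int) (pi : L) (j : nat) : set L :=
  [set t | torus tau t /\ pideal w pi j%:Z (t - 1)].

(** Characters of [T] are functions on [L], of which only the values on [T]
    matter. They are continuous homomorphisms to the multiplicative group of
    the complex numbers; as [T] is compact they are automatically unitary. *)
Record torus_char (R : realType) (k : fieldType) (L : fieldExtType k)
    (tau : 'End(L)) (w : L -> int) (chi : L -> R[i]) : Prop := {
  tchar1 : chi 1 = 1;
  tcharM : forall s t, torus tau s -> torus tau t -> chi (s * t) = chi s * chi t;
  tchar_cont : continuous_char w (torus tau) chi }.

Definition nontrivial_char (R : realType) (k : fieldType) (L : fieldExtType k)
    (tau : 'End(L)) (chi : L -> R[i]) : Prop :=
  exists2 t, torus tau t & chi t != 1.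

Definition char_conductor (R : realType) (k : fieldType) (L : fieldExtType k)
    (tau : 'End(L)) (w : L -> int) (pi : L) (chi : L -> R[i]) (n : nat) : Prop :=
  (forall t, torus_sub tau w pi n t -> chi t = 1) /\
  (forall m : nat, (forall t, torus_sub tau w pi m t -> chi t = 1) -> (n <= m)%N).

(** [s] is a complete system of representatives of [T / T_j]. *)
Record torus_reps (k : fieldType) (L : fieldExtType k) (tau : 'End(L))
    (w : L -> int) (pi : L) (j : nat) (s : seq L) : Prop := {
  reps_uniq : uniq s;
  reps_torus : forall g, g \in s -> torus tau g;
  reps_cover : forall t, torus tau t ->
    exists2 g, g \in s & torus_sub tau w pi j (g^-1 * t);
  reps_inj : forall g h, g \in s -> h \in s ->
    torus_sub tau w pi j (g^-1 * h) -> g = h }.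

(** * The symplectic space and its lattices *)

Definition beta_form (k : fieldType) (L : fieldExtType k) (tau : 'End(L)) (u : L)
    (x y : L) : k := 2%:R^-1 * ext_trace (u * tau x * y).

Definition good_lattice (k : fieldType) (L : fieldExtType k) (w : L -> int)
    (pi1 pi2 : L) (ramified : bool) (mu : int) : set L :=
  if ramified then pideal w pi2 mu else pideal w pi1 ((mu + 1) %/ 2)%Z.

Definition dual_lattice (k : fieldType) (L : fieldExtType k) (v : k -> int)
    (pi : k) (lam : int) (beta : L -> L -> k) (B : set L) : set L :=
  [set x | forall b, B b -> pideal v pi lam (beta x b)].

(** * The lattice model *)

Definition cosets (W : zmodType) (B : set W) : set (set W) :=
  range (fun w => [set w + b | b in B]).

(** The integral over the discrete group [W / B] is the sum over cosets; by
    the first condition the summand does not depend on the representative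
    [xget 0 C] of the coset [C]. *)
Definition lattice_model (R : realType) (k : fieldType) (L : fieldExtType k)
    (psi : k -> R[i]) (beta : L -> L -> k) (B : set L) : set (L -> R[i]) :=
  [set phi |
    (forall b w, B b -> phi (b + w) = psi (2%:R^-1 * beta w b) * phi w) /\
    (\esum_(C in cosets B) (complex.Re (`|phi (xget 0 C)| ^+ 2))%:E < +oo)%E].

Definition delta (R : realType) (k : fieldType) (L : fieldExtType k)
    (psi : k -> R[i]) (beta : L -> L -> k) (B : set L) (x : L) : L -> R[i] :=
  fun w => if `[< B (w - x) >] then psi (2%:R^-1 * beta x (w - x)) else 0.

Definition weil_act (R : realType) (k : fieldType) (L : fieldExtType k)
    (g : L) (phi : L -> R[i]) : L -> R[i] := fun w => phi (g^-1 * w).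

Definition weight_space (R : realType) (k : fieldType) (L : fieldExtType k)
    (tau : 'End(L)) (psi : k -> R[i]) (beta : L -> L -> k) (B : set L)
    (chi : L -> R[i]) : set (L -> R[i]) :=
  [set phi | lattice_model psi beta B phi /\
    forall g, torus tau g -> forall w, weil_act g phi w = chi g * phi w].

Definition occurs (R : realType) (k : fieldType) (L : fieldExtType k)
    (tau : 'End(L)) (psi : k -> R[i]) (beta : L -> L -> k) (B : set L)
    (chi : L -> R[i]) : Prop :=
  exists2 phi, weight_space tau psi beta B chi phi & exists w, phi w != 0.

Definition cline (R : realType) (W : Type) (phi : W -> R[i]) : set (W -> R[i]) :=
  [set (fun w => c * phi w) | c in setT].

(** [\sum_(g in s) chi (g^-1) delta_(c g a)], for a system [s] of
    representatives of [T / T_j]. *)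
Definition phi_chi (R : realType) (k : fieldType) (L : fieldExtType k)
    (psi : k -> R[i]) (beta : L -> L -> k) (B : set L)
    (chi : L -> R[i]) (s : seq L) (c a : L) : L -> R[i] :=
  fun w => \sum_(g <- s) chi g^-1 * delta psi beta B (c * g * a) w.

(** The weight space of [chi] is spanned by
    [\sum_(g in T / T_j) chi (g^-1) delta_(c g a)]. The quotient is finite and
    any system of representatives may be used in the sum. *)
Definition weight_spanned (R : realType) (k : fieldType) (L : fieldExtType k)
    (tau : 'End(L)) (w : L -> int) (pi : L)
    (psi : k -> R[i]) (beta : L -> L -> k) (B : set L)
    (chi : L -> R[i]) (j : nat) (c a : L) : Prop :=
  (exists s, torus_reps tau w pi j s) /\
  forall s, torus_reps tau w pi j s ->
    weight_space tau psi beta B chi = cline (phi_chi psi beta B chi s c a).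

(* Main.v *)
(* The torus permutes the cosets of B, and a vector phi of weight chi with phi(w) <> 0
   forces chi(t) = psi(-1/4 tr(u N(w) t)) for every t that fixes the coset w + B, that is,
   for t in T_j, where j measures how far w is from B.  Self-duality of B says exactly that
   psi o tr is trivial on the ideal of exponent v(u) + 2m (B having exponent m) and on no
   larger one; with the Cayley parametrization of T this shows that the character above
   has conductor exactly 2j, and that on T_j it determines N(w) up to a factor in
   1 + pi^j O.  Such a factor is the square of an element of K (Hensel), so w is determined
   up to T w + B: weight spaces are lines and the orbit sums span them.  In the unramified
   case every character of conductor 2j has this form on T_j, by duality for the finite
   group T_j / T_2j and the surjectivity of the norm on units. *)

Require Import Defs.
From HB Require Import structures.
From mathcomp Require Import all_boot all_order all_algebra all_field.
From mathcomp Require Import complex ring zify.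
From mathcomp Require Import boolp classical_sets reals ereal esum cardinality fsbigop.
Set Implicit Arguments.
Unset Strict Implicit.
Unset Printing Implicit Defensive.
Import Order.TTheory GRing.Theory Num.Theory.
Local Open Scope ring_scope.
Local Open Scope classical_set_scope.

(** * Valuations *)

(** The valuation of [L] is only known to extend that of [k], so its invariance under [tau] and the
    completeness of [K] have to be derived. Completeness and total boundedness pass from [k] to
    subspaces of [L] one basis vector at a time; square roots of principal units of [K] then give
    the invariance.

    Ramified and unramified extensions share most of the argument: the self-dual lattice of exponent
    [m] enters through [D = v(u) + 2 m], and the characters of [T_j] that matter are
    [t |-> Psi (z * t)] with [z] anti-invariant under [tau]. Since [Psi] kills anti-invariant
    elements, such a [z] sees only the anti-invariant part of [t]. The different of [K] serves to
    exclude odd [mu] in the unramified case.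

    Compactness is used in the form of finite lists of representatives, which turns duality into an
    exchange of two finite sums. *)

Section Valuation.
Variables (F : fieldType) (v : F -> int).
Hypothesis hv : normalized_valuation v.

Lemma valuation1 : v 1 = 0.
Proof. by have := Defs.valM hv (oner_neq0 F) (oner_neq0 F); rewrite mulr1; move: (v 1) => x; lia. Qed.

Lemma valuationN1 : v (-1) = 0.
Proof.
have n1 : -1 != 0 :> F by rewrite oppr_eq0 oner_neq0.
by have := Defs.valM hv n1 n1; rewrite mulrNN mulr1 valuation1; lia.
Qed.

Lemma valuationN x : v (- x) = v x.
Proof.
have [->|x0] := eqVneq x 0; first by rewrite oppr0.
by rewrite -mulN1r Defs.valM ?valuationN1 ?add0r // oppr_eq0 oner_neq0.
Qed.

Lemma valuationV x : x != 0 -> v x^-1 = - v x.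
Proof.
move=> x0; have := Defs.valM hv x0 (invr_neq0 x0).
by rewrite mulfV // valuation1; lia.
Qed.

Lemma valuationXn x (n : nat) : x != 0 -> v (x ^+ n) = n%:Z * v x.
Proof.
move=> x0; elim: n => [|n IH]; first by rewrite expr0 valuation1 mul0r.
by rewrite exprS Defs.valM ?expf_neq0 // IH; lia.
Qed.

Lemma valuationXz x (n : int) : x != 0 -> v (x ^ n) = n * v x.
Proof.
move=> x0; case: n => n; first exact: valuationXn.
by rewrite NegzE -exprnN valuationV ?expf_neq0 // valuationXn // mulNr.
Qed.

Lemma vge0 n : vge v n 0. Proof. by left. Qed.

Lemma vgeE n x : x != 0 -> vge v n x <-> n <= v x.
Proof. by move=> x0; split=> [[x00|//]|]; [rewrite x00 eqxx in x0|right]. Qed.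

Lemma vge_le m n x : m <= n -> vge v n x -> vge v m x.
Proof. by move=> mn [->|nx]; [left|right; apply: le_trans nx]. Qed.

Lemma vgeN n x : vge v n x -> vge v n (- x).
Proof. by case=> [->|nx]; [rewrite oppr0; left|right; rewrite valuationN]. Qed.

Lemma vgeD n x y : vge v n x -> vge v n y -> vge v n (x + y).
Proof.
case=> [->|nx]; first by rewrite add0r.
case=> [->|ny]; first by rewrite addr0; right.
have [->|x0] := eqVneq x 0; first by rewrite add0r; right.
have [->|y0] := eqVneq y 0; first by rewrite addr0; right.
have [->|xy0] := eqVneq (x + y) 0; first by left.
right; have := Defs.valD hv x0 y0 xy0; apply: le_trans.
by rewrite le_min nx.
Qed.

Lemma vgeB n x y : vge v n x -> vge v n y -> vge v n (x - y).
Proof. by move=> nx /vgeN; apply: vgeD. Qed.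

Lemma vgeBC n x y : vge v n (x - y) -> vge v n (y - x).
Proof. by move=> /vgeN; rewrite opprB. Qed.

Lemma vgeBD n x y z : vge v n (x - y) -> vge v n (y - z) -> vge v n (x - z).
Proof. by move=> a b; have := vgeD a b; rewrite addrA subrK. Qed.

Lemma vgeM m n x y : vge v m x -> vge v n y -> vge v (m + n) (x * y).
Proof.
have [->|x0] := eqVneq x 0; first by rewrite mul0r; left.
have [->|y0] := eqVneq y 0; first by rewrite mulr0; left.
rewrite !vgeE ?mulf_neq0 // Defs.valM //; lia.
Qed.

Lemma vgeMl n x y : vge v 0 x -> vge v n y -> vge v n (x * y).
Proof. by move=> x0 /(vgeM x0); rewrite add0r. Qed.

Lemma vgeMr n x y : vge v n x -> vge v 0 y -> vge v n (x * y).
Proof. by move=> nx /(vgeM nx); rewrite addr0. Qed.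

Lemma vge_val x : vge v (v x) x. Proof. by right. Qed.

Lemma vge_mulV n x y : x != 0 -> vge v n (x * y) -> vge v (n - v x) y.
Proof.
move=> x0; have [->|y0] := eqVneq y 0; first by left.
rewrite !vgeE ?mulf_neq0 // Defs.valM //; lia.
Qed.

Lemma vgeM_unit n x y : x != 0 -> v x = 0 -> vge v n (x * y) <-> vge v n y.
Proof.
move=> x0 vx; split; first by move=> /(vge_mulV x0); rewrite vx subr0.
by apply: vgeMl; right; rewrite vx.
Qed.

Lemma vgeM_prime x y : vge v 0 x -> vge v 0 y -> vge v 1 (x * y) -> vge v 1 x \/ vge v 1 y.
Proof.
move=> hx hy; have [->|x0] := eqVneq x 0; first by left; left.
have [->|y0] := eqVneq y 0; first by right; left.
move: hx hy; rewrite !vgeE ?mulf_neq0 // Defs.valM // => hx hy hxy.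
by case: (leP 1 (v x)) => h; [left|right]; lia.
Qed.

Lemma vge1 : vge v 0 1. Proof. by right; rewrite valuation1. Qed.

Lemma vge_all x : (forall n : nat, vge v n%:Z x) -> x = 0.
Proof.
move=> h; apply/eqP/negP => /negP x0.
by have /(vgeE _ x0) := h (`|v x|.+1)%N; lia.
Qed.

Lemma valuationDl x y : x != 0 -> vge v (v x + 1) y -> x + y != 0 /\ v (x + y) = v x.
Proof.
move=> x0 yx.
have h : ~ vge v (v x + 1) (x + y).
  by move=> /vgeB /(_ yx); rewrite addrK vgeE //; lia.
have xy0 : x + y != 0 by apply: contra_notN h => /eqP ->; left.
split=> //; apply/eqP; rewrite eq_le.
have : vge v (v x) (x + y).
  by apply: vgeD; [right|apply: vge_le yx; lia].
by move: h; rewrite !vgeE //; lia.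
Qed.

Lemma unit_1D y : vge v 1 y -> 1 + y != 0 /\ v (1 + y) = 0.
Proof.
move=> h; have := @valuationDl 1 y (oner_neq0 F).
by rewrite valuation1 add0r; apply.
Qed.

Lemma pidealE p n : uniformizer v p -> pideal v p n = vge v n.
Proof.
case=> p0 vp; apply/seteqP; split=> x /=.
  case=> y y0 <-; have -> : n = n + 0 by rewrite addr0.
  by apply: vgeM => //; right; rewrite valuationXz // vp; lia.
move=> nx; exists (p ^ (- n) * x); last first.
  by rewrite mulrA -expfzDr // subrr expr0z mul1r.
have pn : vge v (- n) (p ^ (- n)) by right; rewrite valuationXz // vp mulr1.
by have := vgeM pn nx; rewrite addNr.
Qed.

End Valuation.
Arguments vgeMl {F v} hv {n x y}.
Arguments vgeMr {F v} hv {n x y}.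

(** * Representatives and character sums *)

(** The points of the net [c] need not lie in [A]: one element of [A] is kept for each point of [c]
    with a neighbour not yet represented, and [QE] makes all neighbours of that point equivalent. *)
Lemma finite_reps (T : eqType) (A : set T) (E : T -> T -> Prop) (Q : T -> T -> Prop)
    (c : seq T) :
    (forall x, A x -> E x x) -> (forall x y, A x -> A y -> E x y -> E y x) ->
    (forall x, A x -> exists2 y, y \in c & Q y x) ->
    (forall y x x', A x -> A x' -> Q y x -> Q y x' -> E x x') ->
  exists s : seq T, [/\ uniq s, forall g, g \in s -> A g,
    forall x, A x -> exists2 g, g \in s & E g x &
    forall g h, g \in s -> h \in s -> E g h -> g = h].
Proof.
move=> Exx Esym cov QE.
suff [s [us sA scov sinj]] : exists s : seq T, [/\ uniq s, forall g, g \in s -> A g,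
    forall x, A x -> (exists2 y, y \in c & Q y x) -> exists2 g, g \in s & E g x &
    forall g h, g \in s -> h \in s -> E g h -> g = h].
  by exists s; split=> // x Ax; apply: scov => //; apply: cov.
elim: c {cov} => [|y c [s [us sA scov sinj]]].
  by exists [::]; split=> // x _ [].
have [[x [Ax Qyx nE]]|h] := pselect (exists x, [/\ A x, Q y x &
    ~ exists2 g, g \in s & E g x]); last first.
  exists s; split=> // x Ax [z]; rewrite inE => /predU1P[->|zc] Qzx.
    by apply: contrapT => nE; apply: h; exists x.
  by apply: scov => //; exists z.
exists (x :: s); split.
- rewrite /= us andbT; apply/negP => xs; apply: nE; exists x => //; exact: Exx.
- by move=> g; rewrite inE => /predU1P[->//|]; apply: sA.
- move=> x' Ax' [z]; rewrite inE => /predU1P[->|zc] Qzx.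
    by exists x; [rewrite inE eqxx|apply: QE Qyx Qzx].
  case: (scov _ Ax'); first by exists z.
  by move=> g gs Eg; exists g; rewrite // inE gs orbT.
move=> g h; rewrite !inE => /predU1P[->|gs] /predU1P[->|hs] // Egh.
  by case: nE; exists h => //; apply: Esym => //; apply: sA.
  by case: nE; exists g.
exact: sinj.
Qed.

(** Orthogonality of characters: [sigma] permutes the list, so the sum equals [c] times itself. In
    the applications [sigma] is a translation in a group followed by the choice of a
    representative. *)
Lemma sum_shift_eq0 (R : fieldType) (T : eqType) (s : seq T) (f : T -> R) (sigma : T -> T) (c : R) :
  uniq s -> (forall g, g \in s -> sigma g \in s) -> {in s &, injective sigma} ->
  (forall g, g \in s -> f (sigma g) = c * f g) -> c != 1 ->
  \sum_(g <- s) f g = 0.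
Proof.
move=> us ss si sf c1; set S := (X in X = 0).
have : S = c * S.
  rewrite mulr_sumr -(eq_big_seq _ sf) -(big_map sigma xpredT f) /S.
  apply: perm_big; rewrite perm_sym; apply: uniq_perm => //.
    by rewrite map_inj_in_uniq.
  have um : uniq [seq sigma i | i <- s] by rewrite map_inj_in_uniq.
  have sub : {subset [seq sigma i | i <- s] <= s}.
    by move=> _ /mapP[g gs ->]; apply: ss.
  by have [] := uniq_min_size um sub; rewrite ?size_map.
move=> /eqP; rewrite -subr_eq0 -{1}[S]mul1r -mulrBl mulf_eq0 subr_eq0 eq_sym.
by rewrite (negPf c1) => /eqP.
Qed.

Lemma count_mem_sum (T : eqType) (s l : seq T) : uniq s -> {subset l <= s} ->
  (\sum_(y <- s) count_mem y l = size l)%N.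
Proof.
move=> us; elim: l => [|x l IH] sl; first by apply: big1.
rewrite /= big_split /= IH; last by move=> y yl; apply: sl; rewrite inE yl orbT.
rewrite -[RHS]add1n; congr (_ + _)%N.
have <- : count_mem x s = 1%N by rewrite count_uniq_mem // sl // mem_head.
by rewrite -sum1_count [RHS]big_mkcond; apply: eq_bigr => y _; rewrite /= eq_sym; case: eqP.
Qed.

(** * Finite-dimensional spaces over a complete field *)

Section FiniteDimension.
Variables (k : fieldType) (v : k -> int) (Fq : finFieldType) (res : k -> Fq).
Hypothesis hk : local_field0 v res.
Variables (pi : k) (L : fieldExtType k) (w : L -> int) (e : nat).
Hypothesis hpi : uniformizer v pi.
Hypothesis hw : normalized_valuation w.
Hypothesis e_gt0 : (0 < e)%N.
Hypothesis hwv : forall c : k, c != 0 -> w c%:A = e%:Z * v c.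

Let hv : normalized_valuation v := lf_val hk.

Definition complete_in (U : {vspace L}) : Prop :=
  forall s : nat -> L, (forall i, s i \in U) ->
    (forall n : int, exists N, forall i j : nat,
        (N <= i)%N -> (N <= j)%N -> vge w n (s i - s j)) ->
    exists2 l, l \in U & forall n : int, exists N, forall i : nat,
        (N <= i)%N -> vge w n (s i - l).

(** Total boundedness of the balls of [U], the form in which compactness yields finite lists. The
    points of the net may lie outside [U]. *)
Definition finite_nets_in (U : {vspace L}) : Prop :=
  forall n n' : int, exists c : seq L, forall y, y \in U -> vge w n y ->
    exists2 z, z \in c & vge w n' (y - z).

Lemma valuationZ (c : k) (x : L) :
  c != 0 -> x != 0 -> w (c *: x) = e%:Z * v c + w x.
Proof.
move=> c0 x0; rewrite -mulr_algl (Defs.valM hw) ?hwv //.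
by rewrite scaler_eq0 oner_eq0 orbF.
Qed.

Lemma vgeZ n m (c : k) (x : L) :
  vge v n c -> vge w m x -> vge w (e%:Z * n + m) (c *: x).
Proof.
have [->|c0] := eqVneq c 0; first by rewrite scale0r; left.
have [->|x0] := eqVneq x 0; first by rewrite scaler0; left.
rewrite !vgeE ?scaler_eq0 ?negb_or ?c0 // valuationZ // => nc mx.
by apply: lerD => //; apply: ler_wpM2l.
Qed.

(** Digit expansion: each step appends a chosen lift of one of the finitely many residue classes,
    times the next power of [pi]. *)
Lemma base_finite_nets (n : int) (l : nat) : exists c : seq k,
  forall x, vge v n x -> exists2 y, y \in c & vge v (n + l%:Z) (x - y).
Proof.
have [p0 vp] := hpi.
elim: l => [|l [c hc]].
  by exists [:: 0] => x nx; exists 0; rewrite ?inE // addr0 subr0.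
have [lift hlift] := choice (fun z => (exists2P _ _).1 (res_surj (lf_res hk) z)).
exists [seq y + pi ^ (n + l%:Z) * lift z | y <- c, z <- enum Fq] => x nx.
have [y yc xy] := hc _ nx.
have pl0 : pi ^ (n + l%:Z) != 0 by rewrite expfz_neq0.
pose r := pi ^ (- (n + l%:Z)) * (x - y).
have r0 : integers v r.
  have h : vge v (- (n + l%:Z)) (pi ^ (- (n + l%:Z))).
    by right; rewrite valuationXz // vp mulr1.
  by have := vgeM hv h xy; rewrite addNr.
exists (y + pi ^ (n + l%:Z) * lift (res r)).
  by apply/allpairsP; exists (y, res r); rewrite mem_enum.
have [lr0 lrr] := hlift (res r).
have -> : x - (y + pi ^ (n + l%:Z) * lift (res r)) =
    pi ^ (n + l%:Z) * (r - lift (res r)).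
  by rewrite mulrBr /r mulrA -expfzDr // subrr mul1r opprD addrA.
have -> : n + l.+1%:Z = (n + l%:Z) + 1 by lia.
apply: vgeM => //; first by right; rewrite valuationXz // vp mulr1.
have lN : integers v (- lift (res r)) by apply: vgeN.
apply/(res_ker (lf_res hk)); first exact: vgeB.
rewrite (resD (lf_res hk)) // -[X in X + _]lrr -(resD (lf_res hk)) //.
by rewrite subrr; apply/(res_ker (lf_res hk)); left.
Qed.

(* A complete subspace is closed, hence at positive distance from every outside point. *)
Lemma complete_in_dist (V : {vspace L}) x : complete_in V -> x \notin V ->
  exists N, forall y, y \in V -> ~ vge w N (x - y).
Proof.
move=> cV xV; apply: contrapT => h.
have {}h (N : nat) : exists y, y \in V /\ vge w N%:Z (x - y).
  apply: contrapT => hN; apply: h; exists N%:Z => y yV xy.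
  by apply: hN; exists y.
have [s hs] := choice h.
have [i|n|l lV hl] := cV s; first by case: (hs i).
  exists `|n|%N => i j ni nj.
  apply: (vgeBD hw (y := x)).
    by apply: vgeBC => //; apply: vge_le (hs i).2; lia.
  by apply: vge_le (hs j).2; lia.
case/negP: xV; suff /eqP : x - l = 0 by rewrite subr_eq0 => /eqP ->.
apply: (vge_all (v := w)) => n; have [N hN] := hl n%:Z.
apply: (vgeBD hw (y := s (maxn n N))); last by apply: hN; lia.
by apply: vge_le (hs _).2; lia.
Qed.

(** Division by [c] turns [y + c *: x] into [x] minus a vector of [V], which cannot be small because
    [x] is at positive distance from [V]. Hence the coordinate along [x] is continuous. *)
Lemma coef_bound (V : {vspace L}) x : complete_in V -> x \notin V ->
  exists N, forall n y c, y \in V -> vge w n (y + c *: x) ->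
    c = 0 \/ n - N <= e%:Z * v c.
Proof.
move=> cV xV; have [N hN] := complete_in_dist cV xV.
exists N => n y c yV nyc; have [->|c0] := eqVneq c 0; [by left|right].
have /hN h : - (c^-1 *: y) \in V by rewrite memvN memvZ.
have z0 : x - - (c^-1 *: y) != 0 by apply: contra_notN h => /eqP ->; left.
move: h; rewrite vgeE // => /negP; rewrite -ltNge => h.
have yc : y + c *: x = c *: (x - - (c^-1 *: y)).
  by rewrite opprK scalerDr scalerA mulfV // scale1r addrC.
move: nyc; rewrite yc vgeE; last by rewrite scaler_eq0 negb_or c0.
rewrite valuationZ // lerBlDr => /le_trans; apply.
by rewrite lerD2l ltW.
Qed.

(** By [coef_bound], Cauchy sequences and bounded vectors of the sum have Cauchy, respectively
    bounded, coordinates: the sum carries the product topology. *)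
Lemma complete_nets_add (V : {vspace L}) x : x \notin V ->
  complete_in V -> finite_nets_in V ->
  complete_in (<[x]> + V) /\ finite_nets_in (<[x]> + V).
Proof.
move=> xV cV nV; have [N hN] := coef_bound cV xV.
have dec y : y \in (<[x]> + V)%VS -> exists c z, z \in V /\ y = z + c *: x.
  move=> /memv_addP[_ /vlineP[c ->] [z zV ->]].
  by exists c, z; rewrite addrC.
split=> [s sV sc|n n'].
  have /choice[c /choice[z hz]] := fun i => dec _ (sV i).
  have diff i j : s i - s j = (z i - z j) + (c i - c j) *: x.
    by rewrite (hz i).2 (hz j).2 scalerBl; ring.
  have cc n : exists N, forall i j : nat,
      (N <= i)%N -> (N <= j)%N -> vge v n (c i - c j).
    have [M hM] := sc (N + e%:Z * n); exists M => i j Mi Mj.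
    have := hM i j Mi Mj; rewrite diff => /hN.
    have zV : z i - z j \in V by rewrite memvB // ?(hz i).1 ?(hz j).1.
    move=> /(_ zV)[->|h]; [by left|right].
    by rewrite -(ler_pM2l (x := e%:Z)) //; lia.
  have [c0 hc0] := lf_complete hk cc.
  have cx n : exists N, forall i, (N <= i)%N -> vge w n ((c i - c0) *: x).
    have [M hM] := hc0 (`|n| + `|w x|); exists M => i Mi.
    apply: (vge_le (n := e%:Z * (`|n| + `|w x|) + w x)); first by nia.
    by apply: vgeZ (hM _ Mi) _; right.
  have [i|n|z0 z0V hz0] := cV z; first by case: (hz i).
    have [M1 h1] := sc n; have [M2 h2] := cx n.
    exists (maxn M1 M2) => i j; rewrite !geq_max => /andP[i1 i2] /andP[j1 j2].
    have -> : z i - z j = (s i - s j) - ((c i - c0) *: x - (c j - c0) *: x).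
      by rewrite diff -scalerBl opprB addrA subrK addrK.
    by apply: vgeB => //; [apply: h1|apply: vgeB => //; apply: h2].
  exists (z0 + c0 *: x).
    by rewrite addrC; apply: memv_add => //; apply: memvZ; apply: memv_line.
  move=> n; have [M1 h1] := hz0 n; have [M2 h2] := cx n.
  exists (maxn M1 M2) => i; rewrite !geq_max => /andP[i1 i2].
  have -> : s i - (z0 + c0 *: x) = (z i - z0) + (c i - c0) *: x.
    by rewrite (hz i).2 scalerBl; ring.
  by apply: vgeD => //; [apply: h1|apply: h2].
(* [n1] bounds from below the valuation of the coefficient along [x]; [n2] is a precision at which
   the error in that coefficient, multiplied by [x], has exponent [n']. *)
pose n1 := - (`|n| + `|N|).
pose n2 := `|n'| + `|w x|.
have [ck hck] := base_finite_nets n1 `|n2 - n1|%N.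
have [cVs hcV] := nV (Num.min n (e%:Z * n1 + w x)) n'.
exists [seq a + b *: x | a <- cVs, b <- ck] => y /dec[c [z [zV ->]]] nz.
have vc : vge v n1 c.
  case: (hN _ _ _ zV nz) => [->|h]; [by left|right].
  by rewrite /n1; nia.
have [b bck hb] := hck _ vc.
have zn : vge w (Num.min n (e%:Z * n1 + w x)) z.
  rewrite -[z](addrK (c *: x)); apply: vgeB => //.
    by apply: vge_le nz; rewrite ge_min lexx.
  apply: (vge_le (n := e%:Z * n1 + w x)); first by rewrite ge_min lexx orbT.
  by apply: vgeZ => //; right.
have [a acV ha] := hcV _ zV zn.
exists (a + b *: x); first by apply/allpairsP; exists (a, b).
have -> : z + c *: x - (a + b *: x) = (z - a) + (c - b) *: x.
  by rewrite scalerBl; ring.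
apply: vgeD => //.
apply: (vge_le (n := e%:Z * n2 + w x)); first by rewrite /n2; nia.
by apply: vgeZ; [apply: vge_le hb; lia|right].
Qed.

Lemma complete_nets (U : {vspace L}) : complete_in U /\ finite_nets_in U.
Proof.
rewrite -(span_basis (vbasisP U)); elim: (vbasis U : seq L) => [|x X [cX nX]].
  rewrite span_nil; split=> [s s0 _|n n'].
    exists 0; first exact: mem0v.
    move=> n; exists 0%N => i _; have := s0 i.
    by rewrite memv0 => /eqP ->; rewrite subrr; left.
  by exists [:: 0] => y; rewrite memv0 => /eqP -> _; exists 0; rewrite ?inE // subrr; left.
rewrite span_cons; have [xX|xX] := boolP (x \in <<X>>%VS).
  by rewrite (addv_idPr _) // -memvE.
exact: complete_nets_add.
Qed.

End FiniteDimension.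

(** * Quadratic extensions *)

Section QuadraticExtension.
Variables (k : fieldType) (L : fieldExtType k) (w : L -> int) (K : {subfield L}).
Hypothesis hw : normalized_valuation w.
Hypothesis two_neq0 : 2%:R != 0 :> L.
Hypothesis val2 : w 2%:R = 0.
Hypothesis completeK : complete_in w K.

Lemma vge_half n x : vge w n x -> vge w n (x / 2%:R).
Proof. by move=> nx; apply: vgeMr => //; right; rewrite valuationV // val2. Qed.

(** Newton iteration from [1] with the derivative [2 d] frozen at [2]. Each step is only guaranteed
    one more power of the uniformizer, but no division by [d n] occurs and the iterates stay in
    [K]. *)
Lemma sqrt_of_1unit c : c \in K -> vge w 1 (c - 1) ->
  exists d, [/\ d \in K, d ^+ 2 = c & vge w 1 (d - 1)].
Proof.
move=> cK c1.
pose d := fix d n := if n is n'.+1 then d n' - (d n' ^+ 2 - c) / 2%:R else 1 : L.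
have dS n : d n.+1 = d n - (d n ^+ 2 - c) / 2%:R by [].
have two0 : 2%:R != 0 :> L by exact: two_neq0.
have dK n : d n \in K.
  elim: n => [|n IH]; first exact: mem1v.
  rewrite dS rpredB // rpredM ?rpredB ?rpredX // rpredV.
  by rewrite rpredMn // mem1v.
have dP n : vge w 1 (d n - 1) /\ vge w (n%:Z + 1) (d n ^+ 2 - c).
  elim: n => [|n [d1 dc]].
    by rewrite /= subrr expr1n; split; [left|rewrite add0r; apply: vgeBC].
  set eps := d n ^+ 2 - c in dc.
  have e1 : vge w 1 eps by apply: vge_le dc; lia.
  rewrite dS -/eps; split.
    have -> : d n - eps / 2%:R - 1 = (d n - 1) - eps / 2%:R by ring.
    by apply: vgeB => //; apply: vge_half.
  (* The new error is the old one times an element of the maximal ideal. *)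
  have -> : (d n - eps / 2%:R) ^+ 2 - c =
      eps * (- (d n - 1) + eps / 2%:R / 2%:R) by rewrite /eps; field.
  have -> : n.+1%:Z + 1 = n%:Z + 1 + 1 by lia.
  apply: vgeM => //; apply: vgeD => //; first exact: vgeN.
  by do 2 apply: vge_half.
have step n : vge w (n%:Z + 1) (d n.+1 - d n).
  rewrite dS addrAC subrr add0r; apply: vgeN => //; apply: vge_half.
  by case: (dP n).
have dn n m : vge w (n%:Z + 1) (d (n + m)%N - d n).
  elim: m => [|m IH]; first by rewrite addn0 subrr; left.
  rewrite addnS; apply: (vgeBD hw (y := d (n + m)%N)) => //.
  by apply: vge_le (step _); lia.
have [i|n|l lK hl] := completeK (s := d); first exact: dK.
  exists `|n|%N => i j ni nj.
  apply: (vgeBD hw (y := d `|n|%N)).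
    by rewrite -(subnKC ni); apply: vge_le (dn _ _); lia.
  by apply: vgeBC => //; rewrite -(subnKC nj); apply: vge_le (dn _ _); lia.
have l1 : vge w 1 (l - 1).
  have [N hN] := hl 1; apply: (vgeBD hw (y := d N)); last by case: (dP N).
  by apply: vgeBC => //; apply: hN.
exists l; split=> //; apply/eqP; rewrite -subr_eq0; apply/eqP.
apply: (vge_all (v := w)) => n; have [N hN] := hl n%:Z.
set i := maxn n N.
have -> : l ^+ 2 - c = (d i ^+ 2 - c) - (d i - l) * ((d i - 1) + (l - 1) + 2%:R).
  by ring.
apply: vgeB => //; first by apply: vge_le (dP i).2; lia.
apply: vgeMr => //; first by apply: hN; lia.
apply: vgeD => //; last by right; rewrite val2.
by apply: vgeD => //; [apply: vge_le (dP i).1|apply: vge_le l1].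
Qed.

(** In [(d - 1) * (d + 1) = c - 1] the factor [d + 1] is a unit, being congruent to [2]. *)
Lemma sqrt_close n c : c \in K -> 1 <= n -> vge w n (c - 1) ->
  exists d, [/\ d \in K, d ^+ 2 = c & vge w n (d - 1)].
Proof.
move=> cK n1 nc; have [|d [dK dc d1]] := sqrt_of_1unit cK; first exact: vge_le nc.
exists d; split=> //.
have [d0 wd] : d + 1 != 0 /\ w (d + 1) = 0.
  have -> : d + 1 = 2%:R + (d - 1) by ring.
  rewrite -[in X in _ /\ _ = X]val2; apply: valuationDl => //.
  by rewrite val2 add0r.
apply/(vgeM_unit hw _ _ d0 wd).
by have -> : (d + 1) * (d - 1) = d ^+ 2 - 1 by [ring]; rewrite dc.
Qed.

Variables (tau : 'End(L)) (u : L).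
Hypothesis tauM : {morph tau : x y / x * y}.
Hypothesis tau_id : forall x, x \in K -> tau x = x.
Hypothesis u_neq0 : u != 0.
Hypothesis tau_u : tau u = - u.
Hypothesis quad : forall x, exists a b, [/\ a \in K, b \in K & x = a + b * u].

Lemma tauK x : tau (tau x) = x.
Proof.
have [a [b [aK bK ->]]] := quad x.
have tb : tau (b * u) = - (b * u) by rewrite tauM tau_u (tau_id bK) mulrN.
by rewrite linearD /= tb linearB /= tb opprK !(tau_id aK).
Qed.

Lemma tau_fixed x : tau x = x -> x \in K.
Proof.
have [a [b [aK bK ->]]] := quad x.
rewrite raddfD /= tauM tau_u (tau_id aK) (tau_id bK) mulrN => /addrI/eqP.
rewrite eq_sym -addr_eq0 -mulr2n -mulr_natr mulf_eq0 (negPf two_neq0) orbF.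
by move=> /eqP ->; rewrite addr0.
Qed.

Lemma u_notin : u \notin K.
Proof.
apply/negP => /tau_id/eqP; rewrite tau_u eq_sym -addr_eq0 -mulr2n -mulr_natr.
by rewrite mulf_eq0 (negPf two_neq0) orbF (negPf u_neq0).
Qed.

Lemma tau1 : tau 1 = 1. Proof. by rewrite tau_id // mem1v. Qed.

Lemma tau_eq0 x : (tau x == 0) = (x == 0).
Proof.
by apply/eqP/eqP => [h|->]; [rewrite -(tauK x) h|]; rewrite linear0.
Qed.

Lemma tauV x : tau x^-1 = (tau x)^-1.
Proof.
have [->|x0] := eqVneq x 0; first by rewrite invr0 linear0 invr0.
apply: (mulfI (x := tau x)); first by rewrite tau_eq0.
by rewrite -tauM mulfV // tau1 mulfV // tau_eq0.
Qed.

Lemma tauXz x (n : int) : tau (x ^ n) = tau x ^ n.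
Proof.
have tauX m : tau (x ^+ m) = tau x ^+ m.
  by elim: m => [|m IH]; rewrite ?tau1 // !exprS tauM IH.
by case: n => n; rewrite ?tauX // NegzE -!exprnN tauV tauX.
Qed.

(* If [a] were larger than [a + b u], then [(b u / a) ^ 2] would be a principal unit
   of [K], hence a square in [K], which puts [u] in [K]. *)
Lemma vge_fixed_part n a b : a \in K -> b \in K -> vge w n (a + b * u) -> vge w n a.
Proof.
move=> aK bK nx; apply: contrapT => na.
have a0 : a != 0 by apply: contra_notN na => /eqP ->; left.
have b0 : b != 0 by apply: contra_notN na => /eqP b0; rewrite b0 mul0r addr0 in nx.
have {}na : w a < n by move: na; rewrite vgeE // => /negP; rewrite -ltNge.
pose y := (a + b * u) / a.
have y1 : vge w 1 y.
  apply: (vge_le (n := n - w a)); first lia.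
  by apply: vgeM => //; right; rewrite valuationV.
have buE : b * u / a = y - 1 by rewrite /y mulrDl mulfV // addrAC subrr add0r.
have cK : (y - 1) ^+ 2 \in K.
  apply: tau_fixed; rewrite -buE !expr2 !tauM tauV tau_u.
  by rewrite (tau_id aK) (tau_id bK) mulrN mulNr mulrNN.
have [|d [dK dc _]] := sqrt_of_1unit cK.
  have -> : (y - 1) ^+ 2 - 1 = y * (y - 2%:R) by ring.
  apply: vgeMr => //; apply: vgeB => //; first exact: vge_le y1.
  by right; rewrite val2.
have : y - 1 \in K.
  by move/eqP: dc; rewrite eqf_sqr => /orP[/eqP<-|/eqP]; rewrite // => dE;
    rewrite -[y - 1]opprK -dE rpredN.
rewrite -buE => buK; case/negP: u_notin.
have -> : u = b^-1 * (b * u / a) * a by field; rewrite a0 b0.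
by rewrite rpredM // rpredM // rpredV.
Qed.

(** If [a] is the fixed part of [x], then [tau x = 2 a - x]. This stands in for the uniqueness of
    the extension of a valuation. *)
Lemma vge_tau n x : vge w n x -> vge w n (tau x).
Proof.
have [a [b [aK bK ->]]] := quad x => nx.
have na := vge_fixed_part aK bK nx.
rewrite raddfD /= tauM tau_u (tau_id aK) (tau_id bK) mulrN.
have -> : a - b * u = a + a - (a + b * u) by ring.
by apply: vgeB => //; apply: vgeD.
Qed.

Lemma val_tau x : x != 0 -> w (tau x) = w x.
Proof.
move=> x0; have tx0 : tau x != 0 by rewrite tau_eq0.
have /vge_tau := vge_val w x; have /vge_tau := vge_val w (tau x).
by rewrite tauK !vgeE //; lia.
Qed.

Lemma val_torus t : torus tau t -> t != 0 /\ w t = 0.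
Proof.
move=> /= ht; have t0 : t != 0.
  by apply/eqP => t0; move/eqP: ht; rewrite t0 mul0r eq_sym oner_eq0.
split=> //; have := congr1 w ht.
by rewrite (Defs.valM hw) ?tau_eq0 // val_tau // valuation1 //; lia.
Qed.

End QuadraticExtension.

(** * Traces *)

Section Trace.
Variables (k : fieldType) (L : fieldExtType k).

Lemma ext_trace_basis n (X : n.-tuple L) x : basis_of {:L} X ->
  ext_trace x = \sum_(i < n) coord X i (x * X`_i).
Proof.
move=> bX; have bV := vbasisP {:L}; rewrite /ext_trace.
have expand m (Y : m.-tuple L) y : basis_of {:L} Y -> y = \sum_(i < m) coord Y i y *: Y`_i.
  by move=> bY; apply: (coord_basis bY); apply: memvf.
transitivity (\sum_(i < \dim {:L}) \sum_(j < n)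
    coord X j (vbasis {:L})`_i * coord (vbasis {:L}) i (x * X`_j)).
  apply: eq_bigr => i _; rewrite {1}(expand _ _ (vbasis {:L})`_i bX) mulr_sumr linear_sum.
  by apply: eq_bigr => j _; rewrite -scalerAr linearZ.
rewrite exchange_big; apply: eq_bigr => j _.
rewrite [in RHS](expand _ _ (x * X`_j) bV) linear_sum.
by apply: eq_bigr => i _; rewrite linearZ mulrC.
Qed.

Lemma ext_traceD (x y : L) : ext_trace (x + y) = ext_trace x + ext_trace y.
Proof. by rewrite -big_split; apply: eq_bigr => i _; rewrite mulrDl linearD. Qed.

Lemma ext_traceZ (c : k) (x : L) : ext_trace (c *: x) = c * ext_trace x.
Proof. by rewrite mulr_sumr; apply: eq_bigr => i _; rewrite -scalerAl linearZ. Qed.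

Lemma ext_traceN (x : L) : ext_trace (- x) = - ext_trace x.
Proof. by rewrite -scaleN1r ext_traceZ mulN1r. Qed.

Variables (K : {subfield L}) (tau : 'End(L)) (u : L).
Hypothesis two_neq0 : 2%:R != 0 :> L.
Hypothesis tauM : {morph tau : x y / x * y}.
Hypothesis tau_id : forall x, x \in K -> tau x = x.
Hypothesis u_neq0 : u != 0.
Hypothesis tau_u : tau u = - u.
Hypothesis quad : forall x, exists a b, [/\ a \in K, b \in K & x = a + b * u].

Let tauK := tauK tauM tau_id tau_u quad.

(** [tau] carries a basis to a basis, and multiplication by [tau x] has in the image basis the
    matrix that multiplication by [x] has in the original one. *)
Lemma ext_trace_tau (x : L) : ext_trace (tau x) = ext_trace x.
Proof.
have bV := vbasisP {:L}; set X := vbasis {:L} in bV *.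
pose Y := map_tuple tau X.
have YE (i : 'I_(\dim {:L})) : Y`_i = tau X`_i.
  by rewrite (nth_map 0) // size_tuple.
have bY : basis_of {:L} Y.
  have kt : ({:L} :&: lker tau = 0)%VS.
    apply/eqP; rewrite -subv0; apply/subvP => y; rewrite memv_cap memv_ker memv0.
    by rewrite (tau_eq0 tauM tau_id tau_u quad) => /andP[].
  have := limg_basis_of kt bV; suff -> : (tau @: {:L} = {:L})%VS by [].
  apply/eqP; rewrite eqEsubv subvf; apply/subvP => y _.
  by rewrite -(tauK y) memv_img ?memvf.
rewrite (ext_trace_basis _ bY) /ext_trace -/X; apply: eq_bigr => i _.
rewrite YE -tauM {1}(coord_basis bV (memvf (x * X`_i))) linear_sum /=.
under eq_bigr do rewrite linearZ /= -YE.
by rewrite coord_sum_free // (basis_free bY).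
Qed.

Lemma ext_trace_anti x : tau x = - x -> ext_trace x = 0.
Proof.
move=> h; have /eqP := ext_trace_tau x; rewrite h ext_traceN eq_sym -addr_eq0.
rewrite -mulr2n -mulr_natr mulf_eq0 => /orP[/eqP //|/eqP two0].
case/negP: two_neq0; have : 2%:R%:A = 0 :> L by rewrite two0 scale0r.
by rewrite scaler_nat => ->.
Qed.

(** In the basis formed by a basis of [K] and its multiple by [u], multiplication by an element of
    [K] is block diagonal with two equal blocks. This links the trace from [L] to the different of
    [K]. *)
Lemma ext_trace_sub (x : subvs_of K) : \dim {:L} = (2 * \dim K)%N ->
  ext_trace (vsval x) = 2%:R * ext_trace x.
Proof.
move=> dimL; have bV := vbasisP {:subvs_of K}; set X := vbasis {: subvs_of K} in bV *.
have dimX : \dim {: subvs_of K} = \dim K by rewrite dimvf.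
set n := \dim {: subvs_of K} in X bV dimX *.
pose Y := map_tuple vsval X; pose Yu := map_tuple (fun y => y * u) Y.
pose Z := cat_tuple Y Yu.
have YE (i : 'I_n) : Y`_i = vsval X`_i by rewrite (nth_map 0) // size_tuple.
have YuE (i : 'I_n) : Yu`_i = Y`_i * u by rewrite (nth_map 0) // size_tuple.
have ZlE (i : 'I_n) : Z`_(lshift n i) = Y`_i.
  by rewrite nth_cat size_map size_tuple /= ltn_ord.
have ZrE (i : 'I_n) : Z`_(rshift n i) = Yu`_i.
  by rewrite nth_cat size_map size_tuple ltnNge leq_addr /= addKn.
have Yexp (a : subvs_of K) : vsval a = \sum_(i < n) coord X i a *: Y`_i.
  rewrite {1}(coord_basis bV (memvf a)) linear_sum.
  by apply: eq_bigr => i _; rewrite linearZ YE.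
have mY (i : 'I_n) : Y`_i \in <<Z>>%VS.
  by rewrite -ZlE; apply: memv_span; rewrite mem_nth // size_tuple.
have mYu (i : 'I_n) : Yu`_i \in <<Z>>%VS.
  by rewrite -ZrE; apply: memv_span; rewrite mem_nth // size_tuple.
have bZ : basis_of {:L} Z.
  rewrite basisEdim size_tuple dimL -dimX mul2n -addnn leqnn andbT.
  apply/subvP => y _; have [a [b [aK bK ->]]] := quad y.
  rewrite -(vsprojK aK) -(vsprojK bK) memvD //.
    by rewrite Yexp memv_suml // => i _; apply: memvZ.
  rewrite Yexp mulr_suml memv_suml // => i _; rewrite -scalerAl -YuE.
  exact: memvZ.
rewrite (ext_trace_basis _ bZ) big_split_ord /=.
have fZ := basis_free bZ.
have xl (i : 'I_n) : vsval x * Z`_(lshift n i) =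
    \sum_(j < n + n) (if fintype.split j is inl l then coord X l (x * X`_i) else 0) *: Z`_j.
  rewrite ZlE YE -[_ * _]/(vsval (x * X`_i)) Yexp big_split_ord /=.
  rewrite [X in _ + X]big1 ?addr0; last first.
    by move=> j _; rewrite -[rshift n j]/(unsplit (inr j)) unsplitK scale0r.
  apply: eq_bigr => j _.
  by rewrite ZlE -[lshift n j]/(unsplit (inl j)) unsplitK.
have xr (i : 'I_n) : vsval x * Z`_(rshift n i) =
    \sum_(j < n + n) (if fintype.split j is inr l then coord X l (x * X`_i) else 0) *: Z`_j.
  rewrite ZrE YuE YE mulrA -[_ * vsval _]/(vsval (x * X`_i)) Yexp mulr_suml.
  rewrite [RHS]big_split_ord /=.
  rewrite [X in _ = X + _]big1 ?add0r; last first.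
    by move=> j _; rewrite -[lshift n j]/(unsplit (inl j)) unsplitK scale0r.
  apply: eq_bigr => j _.
  by rewrite ZrE -[rshift n j]/(unsplit (inr j)) unsplitK YuE scalerAl.
rewrite -[2%:R]/(1 + 1) mulrDl !mul1r; congr (_ + _); apply: eq_bigr => i _.
  rewrite xl coord_sum_free // -[X in fintype.split X]/(unsplit (inl i)) unsplitK //.
rewrite xr coord_sum_free // -[X in fintype.split X]/(unsplit (inr i)) unsplitK //.
Qed.

End Trace.

Lemma quadratic_decomposition (k : fieldType) (L : fieldExtType k) (K : {subfield L}) u :
  \dim_K {:L} = 2%N -> u \notin K ->
  forall x, exists a b, [/\ a \in K, b \in K & x = a + b * u].
Proof.
move=> hquad uK x.
have u0 : u != 0 by apply: contraNneq uK => ->; rewrite mem0v.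
have dimL : \dim {:L} = (2 * \dim K)%N by rewrite (dim_sup_field (subvf K)) hquad.
have KuL : (K + K * <[u]>)%VS = {:L}%VS.
  apply/eqP; rewrite eqEdim subvf /= dimv_disjoint_sum.
    by rewrite dim_cosetv // dimL mul2n addnn.
  apply/eqP; rewrite -subv0; apply/subvP => y; rewrite memv_cap memv0.
  move=> /andP[yK /memv_cosetP[b bK yE]]; apply: contraNT uK => y0.
  have b0 : b != 0 by apply: contraNneq y0 => b0; rewrite yE b0 mul0r.
  have -> : u = b^-1 * y by rewrite yE mulKf.
  by rewrite rpredM // rpredV.
have : x \in (K + K * <[u]>)%VS by rewrite KuL memvf.
move=> /memv_addP[a aK [_ /memv_cosetP[b bK ->] ->]].
by exists a, b.
Qed.

(** * The lattice model *)

Section LatticeModel.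
Variables (R : realType) (k : fieldType) (v : k -> int) (pi : k) (psi : k -> R[i]) (lam : int).
Variables (L : fieldExtType k) (w : L -> int) (e : nat) (K : {subfield L}).
Variables (tau : 'End(L)) (u pi2 : L) (m : int).
Hypothesis hv : normalized_valuation v.
Hypothesis hpi : uniformizer v pi.
Hypothesis hpsi : unitary_add_char v psi.
Hypothesis hlam : add_conductor v pi psi lam.
Hypothesis hw : normalized_valuation w.
Hypothesis hwv : forall c : k, c != 0 -> w c%:A = e%:Z * v c.
Hypothesis hpi2 : uniformizer w pi2.
Hypothesis base_two_neq0 : 2%:R != 0 :> k.
Hypothesis base_val2 : v 2%:R = 0.
Hypothesis two_neq0 : 2%:R != 0 :> L.
Hypothesis val2 : w 2%:R = 0.
Hypothesis completeK : complete_in w K.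
Hypothesis netsL : finite_nets_in w {:L}.
Hypothesis tauM : {morph tau : x y / x * y}.
Hypothesis tau_id : forall x, x \in K -> tau x = x.
Hypothesis u_neq0 : u != 0.
Hypothesis tau_u : tau u = - u.
Hypothesis quad : forall x, exists a b, [/\ a \in K, b \in K & x = a + b * u].

Let beta := beta_form tau u.
Let B := vge w m.
Hypothesis self_dual : B = dual_lattice v pi lam beta B.

Let tauK : forall x, tau (tau x) = x := tauK tauM tau_id tau_u quad.
Let tau_fixed := tau_fixed two_neq0 tauM tau_id tau_u quad.
Let vge_tau := vge_tau hw two_neq0 val2 completeK tauM tau_id u_neq0 tau_u quad.
Let val_tau := val_tau hw two_neq0 val2 completeK tauM tau_id u_neq0 tau_u quad.
Let val_torus := val_torus hw two_neq0 val2 completeK tauM tau_id u_neq0 tau_u quad.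
Let tau_eq0 := tau_eq0 tauM tau_id tau_u quad.
Let tauV := tauV tauM tau_id tau_u quad.
Let tau1 := tau1 tau_id.
Let ext_trace_tau := ext_trace_tau tauM tau_id tau_u quad.
Let ext_trace_anti := ext_trace_anti two_neq0 tauM tau_id tau_u quad.

(* The exponent of the largest fractional ideal on which [psi \o tr] is trivial. *)
Definition trace_conductor := w u + m + m.
Local Notation D := trace_conductor.

Definition psi_tr (x : L) : R[i] := psi (ext_trace x).
Local Notation Psi := psi_tr.

(** * The torus and the character [psi \o tr] *)

Lemma torus_subE j t : torus_sub tau w pi2 j t <-> torus tau t /\ vge w j%:Z (t - 1).
Proof. by rewrite /torus_sub /= pidealE. Qed.

Lemma torus1 : torus tau 1. Proof. by rewrite /torus /= tau1 mulr1. Qed.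

Lemma torusM s t : torus tau s -> torus tau t -> torus tau (s * t).
Proof. by rewrite /torus /= tauM mulrACA => -> ->; rewrite mulr1. Qed.

Lemma torus_inv t : torus tau t -> t^-1 = tau t.
Proof.
move=> ht; have [t0 _] := val_torus ht.
by rewrite -[RHS](mulKf t0) ht mulr1.
Qed.

Lemma torusV t : torus tau t -> torus tau t^-1.
Proof. by move=> ht; rewrite /torus /= tauV -invfM ht invr1. Qed.

Lemma vge_torus t n x : torus tau t -> vge w n (t * x) <-> vge w n x.
Proof. by move=> /val_torus[t0 wt]; apply: vgeM_unit. Qed.

Lemma vge_divr_torus g h n : torus tau g -> vge w n (g^-1 * h - 1) <-> vge w n (h - g).
Proof.
move=> hg; have [g0 _] := val_torus hg.
have -> : g^-1 * h - 1 = g^-1 * (h - g) by rewrite mulrBr mulVf.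
by apply: vge_torus; apply: torusV.
Qed.

Lemma psi0 : psi 0 = 1.
Proof.
have := addcharD hpsi 0 0; rewrite addr0 => /eqP.
have p0 : psi 0 != 0 by rewrite -normr_gt0 (addchar_norm hpsi).
by rewrite -{1}[psi 0]mulr1 (inj_eq (mulfI p0)) => /eqP.
Qed.

Lemma psi_trD x y : Psi (x + y) = Psi x * Psi y.
Proof. by rewrite /Psi ext_traceD (addcharD hpsi). Qed.

Lemma psi_tr_neq0 x : Psi x != 0.
Proof. by rewrite -normr_gt0 (addchar_norm hpsi). Qed.

Lemma psi_tr_anti x : tau x = - x -> Psi x = 1.
Proof. by move=> /ext_trace_anti; rewrite /Psi => ->; rewrite psi0. Qed.

Lemma psi_tr0 : Psi 0 = 1. Proof. by apply: psi_tr_anti; rewrite linear0 oppr0. Qed.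

Lemma psi_trN x : Psi (- x) = (Psi x)^-1.
Proof.
by apply: (mulfI (psi_tr_neq0 x)); rewrite -psi_trD subrr psi_tr0 mulfV ?psi_tr_neq0.
Qed.

Lemma psi_tr_tau x : Psi (tau x) = Psi x.
Proof. by rewrite /Psi ext_trace_tau. Qed.

Lemma scale_invn n (x : L) : (n%:R^-1 : k) *: x = x / n%:R.
Proof. by rewrite -mulr_algr -in_algE fmorphV rmorph_nat. Qed.

Lemma psi_quarter x : psi (4%:R^-1 * ext_trace x) = Psi (x / 4%:R).
Proof. by rewrite -ext_traceZ scale_invn. Qed.

Lemma psi_half_beta x y : psi (2%:R^-1 * beta x y) = Psi (u * tau x * y / 4%:R).
Proof.
rewrite -psi_quarter /beta /beta_form mulrA -invfM -natrM.
by [].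
Qed.

Lemma four_neq0 : 4%:R != 0 :> L.
Proof. by rewrite (natrM _ 2 2) mulf_neq0. Qed.

Lemma val4 : w 4%:R = 0.
Proof. by rewrite (natrM _ 2 2) (Defs.valM hw) // val2. Qed.

Lemma val_quarter x : x != 0 -> w (x / 4%:R) = w x.
Proof.
move=> x0; rewrite (Defs.valM hw) ?invr_neq0 ?four_neq0 // valuationV ?four_neq0 //.
by rewrite val4 oppr0 addr0.
Qed.

Lemma vge_quarter n x : vge w n (x / 4%:R) <-> vge w n x.
Proof.
rewrite mulrC; apply: vgeM_unit; rewrite ?invr_neq0 ?four_neq0 //.
by rewrite valuationV ?four_neq0 // val4.
Qed.

(** Let [a] generate the lattice and write [x = u * tau a * b]. Since [D = w u + m + m], the factor
    [b] lies in [B], and [ext_trace x] is twice [beta a b]. *)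
Lemma vge_trace x : vge w D x -> vge v lam (ext_trace x).
Proof.
move=> Dx; have [p0 wp] := hpi2.
pose a := pi2 ^ m; have a0 : a != 0 by rewrite expfz_neq0.
have wa : w a = m by rewrite valuationXz // wp mulr1.
have ua0 : u * tau a != 0 by rewrite mulf_neq0 ?tau_eq0.
have Ba : B a by right; rewrite wa.
have Bb : B (x / (u * tau a)).
  have := @vge_mulV _ _ hw D (u * tau a) (x / (u * tau a)) ua0.
  rewrite mulrC divfK // => /(_ Dx).
  rewrite (Defs.valM hw) ?tau_eq0 // val_tau // wa /D.
  by apply: vge_le; lia.
have := Ba; rewrite self_dual => /(_ _ Bb).
rewrite pidealE // /beta /beta_form mulrC [X in ext_trace X]mulrC divfK //.
move=> h; have := vgeM hv (_ : vge v 0 2%:R) h; rewrite add0r mulrCA mulfV // mulr1.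
by apply; right; rewrite base_val2.
Qed.

Lemma psi_tr_trivial x : vge w D x -> Psi x = 1.
Proof. by move=> /vge_trace h; apply: hlam.1; rewrite pidealE. Qed.

(** If [Psi] were trivial one exponent below [D], then [pi2 ^ (m - 1)] would lie in the dual lattice
    but not in [B]. Averaging [x] with [tau x] does not change [Psi x], so the element can be found
    in [K]. *)
Lemma psi_tr_nontrivial : exists x, [/\ x \in K, vge w (D - 1) x & Psi x != 1].
Proof.
suff [x xD px] : exists2 x, vge w (D - 1) x & Psi x != 1.
  exists ((x + tau x) / 2%:R); split.
  - apply: tau_fixed; rewrite tauM linearD /= tauK tauV addrC.
    by rewrite [tau 2%:R]linearMn /= tau1.
  - by apply: vge_half => //; apply: vgeD => //; apply: vge_tau.
  suff -> : Psi ((x + tau x) / 2%:R) = Psi x by [].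
  rewrite -[in RHS](subrK ((x + tau x) / 2%:R) x) psi_trD.
  rewrite [X in _ = X * _]psi_tr_anti ?mul1r //.
  have -> : x - (x + tau x) / 2%:R = (x - tau x) / 2%:R by field.
  rewrite tauM linearB /= tauK tauV [tau 2%:R]linearMn /= tau1.
  by rewrite -mulNr opprB.
apply: contrapT => h.
have {}h x : vge w (D - 1) x -> Psi x = 1.
  by move=> xD; apply/eqP/negP => /negP px; apply: h; exists x.
(* These [x] are stable under the integers of [k]: a trace outside the conductor ideal could be
   rescaled to an element where [psi] is non-trivial. *)
have htr x : vge w (D - 1) x -> vge v lam (ext_trace x).
  move=> xD; apply: contrapT => hx.
  have t0 : ext_trace x != 0 by apply: contra_notN hx => /eqP ->; left.
  have vt : v (ext_trace x) < lam by move: hx; rewrite vgeE // => /negP; rewrite -ltNge.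
  have [z] := hlam.2; rewrite pidealE // => zl /eqP[].
  rewrite -[z](divfK t0) -ext_traceZ; apply: h.
  have z0 : vge v 0 (z / ext_trace x).
    apply: (vge_le (n := (lam - 1) - v (ext_trace x))); first lia.
    by apply: vgeM => //; right; rewrite valuationV.
  by have := vgeZ hw hwv z0 xD; rewrite mulr0 add0r.
have [p0 wp] := hpi2.
pose a := pi2 ^ (m - 1); have a0 : a != 0 by rewrite expfz_neq0.
have wa : w a = m - 1 by rewrite valuationXz // wp mulr1.
suff : B a by rewrite /B vgeE // wa; lia.
rewrite self_dual => b Bb; rewrite pidealE // /beta /beta_form.
have V2 : vge v 0 2%:R^-1 by right; rewrite valuationV // base_val2.
apply: vgeMl => //; apply: htr.
have -> : D - 1 = w u + (m - 1) + m by rewrite /D; lia.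
apply: vgeM => //; apply: vgeM => //; first by right.
by apply: vge_tau; right; rewrite wa.
Qed.

(* Cayley parametrization: for anti-invariant [y] the element [(1 + y) / (1 - y)] of
   the torus has anti-invariant part [2 y / (1 - y ^ 2)]. *)
Lemma anti_char_nontrivial z (l : int) : tau z = - z -> z != 0 -> w z = D - l -> 2 <= l ->
  exists t, [/\ torus tau t, vge w (l - 1) (t - 1) & Psi (z * t) != 1].
Proof.
move=> tz z0 wz l2; have [x [xK xD px]] := psi_tr_nontrivial.
(* Chosen so that [2 z y = x]: to first order, the anti-invariant part of [(1 + y) / (1 - y)]
   contributes [x] to [z * t]. *)
pose y := x / (2%:R * z); have zz0 : 2%:R * z != 0 by rewrite mulf_neq0.
have tau2 : tau 2%:R = 2%:R by rewrite [LHS]linearMn /= tau1.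
have ty : tau y = - y by rewrite /y tauM tauV tauM tz tau2 (tau_id xK) mulrN invrN mulrN.
have yl : vge w (l - 1) y.
  apply: (vge_le (n := D - 1 - w z)); first by rewrite wz; lia.
  apply: vgeM => //; right; rewrite valuationV // (Defs.valM hw) // val2; lia.
have y1 : vge w 1 y by apply: vge_le yl; lia.
have [p1 wp1] := unit_1D hw y1; have [m1 wm1] := unit_1D hw (vgeN hw y1).
exists ((1 + y) / (1 - y)); split.
- rewrite /torus /= tauM tauV linearB linearD /= tau1 ty opprK.
  by field; rewrite p1 m1.
- have -> : (1 + y) / (1 - y) - 1 = 2%:R * y / (1 - y) by field.
  apply: vgeMr => //; last by right; rewrite valuationV // wm1.
  by apply: vgeMl => //; right; rewrite val2.
suff -> : Psi (z * ((1 + y) / (1 - y))) = Psi x by [].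
have yE : x = 2%:R * z * y by rewrite /y mulrC divfK.
have q0 : (1 - y) * (1 + y) != 0 by rewrite mulf_neq0.
(* [a] is anti-invariant, hence killed by [Psi]. The remainder [r] has exponent [D + 1], because
   [2 <= l] puts [y] in the maximal ideal. *)
pose a := z * (1 + y ^+ 2) / ((1 - y) * (1 + y)).
pose r := x * y ^+ 2 / ((1 - y) * (1 + y)).
have -> : z * ((1 + y) / (1 - y)) = a + (x + r).
  by rewrite /a /r yE; field; rewrite p1 m1.
rewrite !psi_trD [Psi a]psi_tr_anti ?[Psi r]psi_tr_trivial ?mul1r ?mulr1 //.
  rewrite /r -mulrA; apply: (vge_le (n := D - 1 + (1 + 1))); first by rewrite addrA subrK lerDl.
  apply: vgeM => //; apply: vgeMr => //; first by rewrite expr2; apply: vgeM.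
  by right; rewrite valuationV // (Defs.valM hw) // wp1 wm1.
rewrite /a !tauM tauV tauM linearB !linearD /= expr2 tauM !tau1 tz !ty mulrNN opprK.
by rewrite mulNr mulNr [(1 + y) * _]mulrC.
Qed.

(** [Psi z = 1] by anti-invariance, so only [z * (t - 1)] counts, and it has exponent [D]. *)
Lemma anti_char_trivial z (l : int) t : tau z = - z -> vge w (D - l) z ->
  vge w l (t - 1) -> Psi (z * t) = 1.
Proof.
move=> tz zl tl; have -> : z * t = z + z * (t - 1) by ring.
rewrite psi_trD psi_tr_anti // mul1r; apply: psi_tr_trivial.
have -> : D = (D - l) + l by rewrite subrK.
exact: vgeM.
Qed.

(** A difference of valuation [D - l] with [l > j] defines a non-trivial character of [T_(l-1)], a
    subgroup of [T_j]; positivity of [j] ensures [2 <= l]. *)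
Lemma anti_char_close z z' (j : nat) : tau z = - z -> tau z' = - z' -> (0 < j)%N ->
  (forall t, torus tau t -> vge w j%:Z (t - 1) -> Psi (z * t) = Psi (z' * t)) ->
  vge w (D - j%:Z) (z - z').
Proof.
move=> tz tz' j0 h; apply: contrapT => nz.
have z0 : z - z' != 0 by apply: contra_notN nz => /eqP ->; left.
have wz : w (z - z') < D - j%:Z by move: nz; rewrite vgeE // => /negP; rewrite -ltNge.
have tzz : tau (z - z') = - (z - z') by rewrite linearB /= tz tz' opprB opprK addrC.
have wE : w (z - z') = D - (D - w (z - z')) by rewrite subKr.
have l2 : 2 <= D - w (z - z') by lia.
have [t [ht tl /eqP[]]] := anti_char_nontrivial tzz z0 wE l2.
rewrite mulrBl psi_trD psi_trN h ?mulfV ?psi_tr_neq0 //.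
by apply: vge_le tl; lia.
Qed.

Lemma anti_char_conductor (chi : L -> R[i]) z (j : nat) :
  tau z = - z -> z != 0 -> w z = D - (2 * j)%:Z -> (0 < j)%N ->
  (forall t, torus tau t -> vge w j%:Z (t - 1) -> chi t = Psi (z * t)) ->
  char_conductor tau w pi2 chi (2 * j).
Proof.
move=> tz z0 wz j0 h; split=> [t /torus_subE[ht tj]|n hn].
  rewrite h //; last by apply: vge_le tj; lia.
  by apply: anti_char_trivial tj => //; right; rewrite wz.
rewrite leqNgt; apply/negP => nj.
have [|t [ht tl /eqP[]]] := anti_char_nontrivial tz z0 wz; first lia.
rewrite -h //; last by apply: vge_le tl; lia.
by apply: hn; apply/torus_subE; split=> //; apply: vge_le tl; lia.
Qed.

(** * Finite systems of representatives in the torus *)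

Lemma torus_finite (i j : nat) : exists s : seq L, [/\ uniq s,
  forall g, g \in s -> torus tau g /\ vge w i%:Z (g - 1),
  forall t, torus tau t -> vge w i%:Z (t - 1) -> exists2 g, g \in s & vge w j%:Z (g - t) &
  forall g h, g \in s -> h \in s -> vge w j%:Z (g - h) -> g = h].
Proof.
have [c hc] := netsL 0 j%:Z.
have [||||s [us sA scov sinj]] := @finite_reps L
  [set t | torus tau t /\ vge w i%:Z (t - 1)] (fun g h => vge w j%:Z (g - h))
  (fun y x => vge w j%:Z (x - y)) c.
- by move=> x _; rewrite subrr; left.
- by move=> x y _ _; apply: vgeBC.
- move=> x [/val_torus[_ wx] _]; apply: hc; first exact: memvf.
  by right; rewrite wx.
- by move=> y x x' _ _ xy x'y; apply: (vgeBD hw (y := y)) => //; apply: vgeBC.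
by exists s; split=> // t ht ti; apply: scov.
Qed.

Lemma torus_repsE (j : nat) (s : seq L) : torus_reps tau w pi2 j s <->
  [/\ uniq s, forall g, g \in s -> torus tau g,
    forall t, torus tau t -> exists2 g, g \in s & vge w j%:Z (g - t) &
    forall g h, g \in s -> h \in s -> vge w j%:Z (g - h) -> g = h].
Proof.
have E g h : torus tau g -> torus tau h ->
    torus_sub tau w pi2 j (g^-1 * h) <-> vge w j%:Z (g - h).
  move=> hg hh; rewrite torus_subE vge_divr_torus //; split.
    by move=> [_ /vgeBC]; apply.
  move=> /vgeBC gh; split; last exact: gh.
  by apply: torusM => //; apply: torusV.
split=> [[us st sc si]|[us st sc si]]; split=> //.
- by move=> t ht; have [g gs /(E _ _ (st _ gs) ht)] := sc t ht; exists g.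
- by move=> g h gs hs gh; apply: si => //; apply/E => //; apply: st.
- by move=> t ht; have [g gs gt] := sc t ht; exists g => //; apply/E => //; apply: st.
- by move=> g h gs hs /(E _ _ (st _ gs) (st _ hs)); apply: si.
Qed.

Lemma torus_reps_exists (j : nat) : exists s, torus_reps tau w pi2 j s.
Proof.
have [s [us st sc si]] := torus_finite 0 j; exists s; apply/torus_repsE; split=> //.
  by move=> g /st[].
move=> t ht; apply: sc => //; apply: vgeB => //; last exact: vge1.
by right; rewrite (val_torus ht).2.
Qed.


(** * Weight vectors: stabilizers, supports and conductors *)

Local Notation weight := (weight_space tau psi beta B).

(* [t |-> Psi (orbit_param x * t)] is the character by which the stabilizer of [x + B]
   in the torus acts on vectors that do not vanish at [x]. *)
Definition orbit_param (x : L) : L := - (u * (x * tau x) / 4%:R).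
Local Notation Z := orbit_param.

Lemma tau_nat n : tau n%:R = n%:R.
Proof. by rewrite linearMn /= tau1. Qed.

Lemma orbit_param_anti x : tau (Z x) = - Z x.
Proof.
rewrite /Z linearN /= !tauM tauV tau_u tauK tau_nat [tau x * x]mulrC.
by rewrite mulNr mulNr.
Qed.

Lemma orbit_param_neq0 x : x != 0 -> Z x != 0.
Proof.
by move=> x0; rewrite oppr_eq0 !mulf_neq0 ?tau_eq0 // invr_neq0 // four_neq0.
Qed.

Lemma val_orbit_param x : x != 0 -> w (Z x) = w u + w x + w x.
Proof.
move=> x0; rewrite valuationN // val_quarter ?mulf_neq0 ?tau_eq0 //.
by rewrite !(Defs.valM hw) ?mulf_neq0 ?tau_eq0 // val_tau // addrA.
Qed.

Lemma vge_torus1 t n x : torus tau t -> vge w n ((t - 1) * x) -> vge w n ((t^-1 - 1) * x).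
Proof.
move=> ht h; have [t0 _] := val_torus ht.
have -> : (t^-1 - 1) * x = - (t^-1 * ((t - 1) * x)) by field.
by apply: vgeN => //; apply/vge_torus => //; apply: torusV.
Qed.

Lemma lattice_modelB phi x b : lattice_model psi beta B phi -> B b ->
  phi (b + x) = Psi (u * tau x * b / 4%:R) * phi x.
Proof. by move=> [h _] Bb; rewrite h // psi_half_beta. Qed.

(** Here [t^-1 * x] lies in [x + B], so the value of [phi] at this point is given both by the weight
    and by the quasi-periodicity of the lattice model. *)
Lemma weight_stabilizer chi phi x t : weight chi phi -> phi x != 0 -> torus tau t ->
  vge w m ((t - 1) * x) -> chi t = Psi (Z x * t).
Proof.
move=> [hphi hchi] px ht tx; have [t0 _] := val_torus ht.
have := hchi t ht x; rewrite /weil_act.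
have -> : t^-1 * x = (t^-1 - 1) * x + x by ring.
rewrite lattice_modelB //; last exact: vge_torus1.
move=> /(mulIf px) <-; rewrite torus_inv //.
(* [Psi] is invariant under [tau] and trivial on the anti-invariant [Z x], so only [Z x * t]
   remains. *)
have -> : u * tau x * ((tau t - 1) * x) / 4%:R = tau (Z x * t) + Z x.
  by rewrite tauM orbit_param_anti /Z; field; exact: four_neq0.
by rewrite psi_trD psi_tr_tau [Psi (Z x)]psi_tr_anti ?mulr1 // orbit_param_anti.
Qed.

Lemma beta_trivial x y : B x -> B y -> Psi (u * tau x * y / 4%:R) = 1.
Proof.
move=> Bx By; apply: psi_tr_trivial; apply/vge_quarter.
by apply: vgeM => //; apply: vgeM => //; [right|apply: vge_tau].
Qed.

Lemma weight_lattice_trivial chi phi x t : weight chi phi -> phi x != 0 -> B x ->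
  torus tau t -> chi t = 1.
Proof.
move=> hphi px Bx ht; have [t0 wt] := val_torus ht.
have Bt : B (t * x) by apply/vge_torus.
rewrite (weight_stabilizer hphi px ht); last first.
  by rewrite mulrBl mul1r; apply: vgeB.
have -> : Z x * t = - (u * tau x * (t * x) / 4%:R) by rewrite /Z; ring.
by rewrite psi_trN beta_trivial // invr1.
Qed.

Lemma weight_support chi phi x : weight chi phi -> phi x != 0 -> ~ B x ->
  exists j : nat, [/\ (0 < j)%N, x != 0, w x = m - j%:Z &
    forall t, torus tau t -> vge w j%:Z (t - 1) -> chi t = Psi (Z x * t)].
Proof.
move=> hphi px nBx.
have x0 : x != 0 by apply: contra_notN nBx => /eqP ->; left.
have wx : w x < m by move: nBx; rewrite /B vgeE // => /negP; rewrite -ltNge.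
exists `|m - w x|%N; split=> //; try lia.
move=> t ht tj; apply: (weight_stabilizer hphi px ht).
have -> : m = `|m - w x|%N%:Z + w x by lia.
by apply: vgeM => //; right.
Qed.

(** [Z x] has valuation [w u + 2 (m - j) = D - 2 j]: the norm doubles the distance [j], which is why
    conductors are even. *)
Lemma orbit_conductor (chi : L -> R[i]) x (j : nat) :
  (0 < j)%N -> x != 0 -> w x = m - j%:Z ->
  (forall t, torus tau t -> vge w j%:Z (t - 1) -> chi t = Psi (Z x * t)) ->
  char_conductor tau w pi2 chi (2 * j).
Proof.
move=> j0 x0 wx; apply: anti_char_conductor => //; first exact: orbit_param_anti.
  exact: orbit_param_neq0.
by rewrite val_orbit_param // wx /D; lia.
Qed.

Lemma char_conductor_uniq (chi : L -> R[i]) n n' : char_conductor tau w pi2 chi n ->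
  char_conductor tau w pi2 chi n' -> n = n'.
Proof. by move=> [h1 h2] [h1' h2']; apply/eqP; rewrite eqn_leq h2 // h2'. Qed.

(* The norm of [x / x0] is a principal unit, hence the square of some [d] in [K],
   and [x / (d x0)] lies in the torus. *)
Lemma orbit_param_close x x0 (j : nat) : (0 < j)%N -> x != 0 -> x0 != 0 ->
  w x = m - j%:Z -> w x0 = m - j%:Z -> vge w (D - j%:Z) (Z x - Z x0) ->
  exists2 g, torus tau g & B (x - g * x0).
Proof.
move=> j0 xn0 x0n0 wx wx0 h.
pose a := x / x0; pose c := a * tau a.
have a0 : a != 0 by rewrite mulf_neq0 ?invr_neq0.
have cK : c \in K by apply: tau_fixed; rewrite /c tauM tauK mulrC.
have ZE : Z x - Z x0 = Z x0 * (c - 1).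
  rewrite /Z /c /a tauM tauV; field.
  by rewrite four_neq0 x0n0 tau_eq0 x0n0.
have c1 : vge w j%:Z (c - 1).
  move: h; rewrite ZE => /vge_mulV -/(_ hw (orbit_param_neq0 x0n0)).
  by rewrite val_orbit_param // wx0; apply: vge_le; rewrite /D; lia.
have [|d [dK dc d1]] := sqrt_close hw two_neq0 val2 completeK cK _ c1; first lia.
have d0 : d != 0.
  apply/eqP => d0; move/eqP: dc; rewrite d0 expr0n eq_sym /c.
  by rewrite mulf_eq0 tau_eq0 (negPf a0).
have wd : w d = 0.
  have [|_] := unit_1D hw (y := d - 1); first by apply: vge_le d1; lia.
  by rewrite addrC subrK.
exists (a / d); first by rewrite /torus /= tauM tauV (tau_id dK) mulrACA -/c -dc; field.
have -> : x - a / d * x0 = d^-1 * (x * (d - 1)).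
  by rewrite /a; field; rewrite x0n0 d0.
apply: vgeMl => //; first by right; rewrite valuationV // wd.
have -> : m = (m - j%:Z) + j%:Z by rewrite subrK.
by apply: vgeM => //; right; rewrite wx.
Qed.

(** The support meets only finitely many cosets, collected in [S]; all other terms of the sum
    vanish. *)
Lemma lattice_model_summable (phi : L -> R[i]) (c : seq L) :
  (forall y, phi y != 0 -> exists2 g, g \in c & B (y - g)) ->
  (\esum_(C in cosets B) (complex.Re (`|phi (xget 0 C)| ^+ 2))%:E < +oo)%E.
Proof.
move=> hc; pose S := [set [set g + b | b in B] | g in [set` c]].
have fS : finite_set S by apply: finite_image; apply: finite_seq.
have ge0 z : 0 <= complex.Re (`|z : R[i]| ^+ 2) :> R.
  have : 0 <= `|z| ^+ 2 by rewrite exprn_ge0.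
  by rewrite lecE => /andP[].
rewrite (esumID S); last by move=> C _; rewrite lee_fin.
rewrite [X in (_ + X)%E]esum1 ?adde0; last first.
  move=> C [[y _ yC] nS]; have [->|p0] := eqVneq (phi (xget 0 C)) 0.
    by rewrite normr0 expr0n.
  have Cy : C (xget 0 C).
    apply: (xgetPex 0); exists y; rewrite -yC; exists 0; rewrite ?addr0 //.
    exact: vge0.
  have [g gc Bg] := hc _ p0; case: nS; exists g => //.
  move: Cy Bg; rewrite -{1}yC; set x := xget 0 C => -[b Bb xE] Bg.
  rewrite -yC; apply/seteqP; split=> z [b' Bb' <-] /=.
    exists (g + b' - y); last by ring.
    have -> : g + b' - y = b' + b - (x - g) by rewrite -xE; ring.
    by apply: vgeB => //; apply: vgeD.
  exists (y + b' - g); last by ring.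
  have -> : y + b' - g = b' - b + (x - g) by rewrite -xE; ring.
  by apply: vgeD => //; apply: vgeB.
rewrite esum_fset; last 2 first.
- exact: finite_setIr.
- by move=> C _; rewrite lee_fin.
rewrite fsbig_finite ?sumEFin ?ltry //; exact: finite_setIr.
Qed.

Lemma deltaE x y : delta psi beta B x y =
  if `[< B (y - x) >] then Psi (u * tau x * (y - x) / 4%:R) else 0.
Proof. by rewrite /delta psi_half_beta. Qed.

Lemma delta0E y : delta psi beta B 0 y = if `[< B y >] then 1 else 0.
Proof. by rewrite deltaE subr0 linear0 mulr0 !mul0r psi_tr0. Qed.

Lemma trivial_weight_space : weight (fun=> 1) = cline (delta psi beta B 0).
Proof.
have B0 : B 0 by exact: vge0.
apply/seteqP; split=> phi.
  move=> hphi; exists (phi 0) => //; apply: funext => y; rewrite delta0E.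
  case: asboolP => By.
    by rewrite mulr1 -[y]addr0 (lattice_modelB _ hphi.1 By) linear0 mulr0 !mul0r psi_tr0 mul1r.
  rewrite mulr0; apply/esym/eqP/negP => /negP py.
  (* A nonzero value outside [B] would give the trivial character the conductor [2 j > 0]. *)
  have [j [j0 y0 wy hy]] := weight_support hphi py By.
  have [_ /(_ 0%N)] := orbit_conductor j0 y0 wy hy.
  by rewrite leqn0 muln_eq0 /= => /(_ (fun _ _ => erefl)) /eqP; lia.
move=> [c _ <-]; split=> [|g hg y]; last first.
  rewrite /weil_act mul1r !delta0E; congr (_ * _).
  by rewrite (asbool_equiv_eq (vge_torus m y (torusV hg))).
split=> [b y Bb|].
  rewrite psi_half_beta !delta0E.
  case: asboolP => Bby; case: asboolP => By; rewrite ?mulr0 //.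
  - by rewrite beta_trivial // mul1r.
  - by case: By; rewrite -[y](addKr b) addrC; apply: vgeB.
  - by case: Bby; apply: vgeD.
apply: (@lattice_model_summable (fun y => c * delta psi beta B 0 y) [:: 0]) => y.
rewrite delta0E; case: asboolP => By; last by rewrite mulr0 eqxx.
by move=> _; exists 0; rewrite ?inE // subr0.
Qed.

(** * The orbit sum of a character spans its weight space *)

Section WeightVector.
Variables (chi : L -> R[i]) (j : nat) (x0 : L) (s : seq L).
Hypothesis hchi : torus_char tau w chi.
Hypothesis j_gt0 : (0 < j)%N.
Hypothesis x0_neq0 : x0 != 0.
Hypothesis val_x0 : w x0 = m - j%:Z.
Hypothesis chiE : forall t, torus tau t -> vge w j%:Z (t - 1) -> chi t = Psi (Z x0 * t).
Hypothesis hs : torus_reps tau w pi2 j s.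

Definition torus_average (y : L) : R[i] :=
  \sum_(g <- s) chi g^-1 * delta psi beta B (g * x0) y.
Local Notation Phi := torus_average.

Lemma chi_mulV t : torus tau t -> chi t * chi t^-1 = 1.
Proof.
move=> ht; have [t0 _] := val_torus ht.
by rewrite -(tcharM hchi) ?mulfV ?(tchar1 hchi) //; apply: torusV.
Qed.

Lemma lattice_orbit g h : B ((g - h) * x0) <-> vge w j%:Z (g - h).
Proof.
rewrite /B; split=> h1.
  by move: h1; rewrite mulrC => /(vge_mulV hw x0_neq0); apply: vge_le; rewrite val_x0; lia.
have -> : m = j%:Z + w x0 by rewrite val_x0; lia.
by apply: vgeM => //; right.
Qed.

(** Only the representative [h] congruent to [g] contributes. Expressing the value through [g] alone
    frees the later checks of quasi-periodicity and weight from the choice of representatives. *)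
Lemma torus_average_orbit g b : torus tau g -> B b ->
  Phi (g * x0 + b) = chi g^-1 * Psi (u * tau (g * x0) * b / 4%:R).
Proof.
move=> hg Bb; have [us st sc si] := (torus_repsE j s).1 hs.
have [h h_s gh] := sc g hg; have hh := st _ h_s.
have [h0 _] := val_torus hh; have [g0 _] := val_torus hg.
have ghB : B ((g - h) * x0) by apply/lattice_orbit; apply: vgeBC.
have in_B h' : B (g * x0 + b - h' * x0) <-> vge w j%:Z (g - h').
  rewrite -lattice_orbit.
  have -> : g * x0 + b - h' * x0 = (g - h') * x0 + b by ring.
  split=> hB; last exact: vgeD.
  by rewrite -[_ * x0](addrK b); apply: vgeB.
rewrite /Phi (bigD1_seq h) //= [X in _ + X]big1_seq ?addr0; last first.
  move=> h' /andP[h'h h's]; rewrite deltaE; case: asboolP; rewrite ?mulr0 //.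
  move=> /in_B gh'; case/eqP: h'h; apply: si => //.
  by apply: (vgeBD hw (y := g)) => //; apply: vgeBC.
rewrite deltaE asboolT; last by apply/in_B; apply: vgeBC.
pose t := h^-1 * g.
have ht : torus tau t by apply: torusM => //; apply: torusV.
have tj : vge w j%:Z (t - 1) by apply/vge_divr_torus => //; apply: vgeBC.
(* With [t = h^-1 * g] in [T_j], the exponent splits into a part giving the inverse of [chi t], an
   anti-invariant part, the expected part, and a pairing of two vectors of [B]. *)
have -> : u * tau (h * x0) * (g * x0 + b - h * x0) / 4%:R =
    - (Z x0 * t) + Z x0 + (u * tau (g * x0) * b / 4%:R -
      u * tau ((g - h) * x0) * b / 4%:R).
  rewrite mulrBl [tau (_ - _)]linearB /= !tauM -(torus_inv hh) /Z /t; field.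
  by rewrite four_neq0 h0.
rewrite psi_trD (psi_trD (_ * b / _)) [Psi (- (u * _ * _ / _))]psi_trN.
rewrite beta_trivial // invr1 mulr1 mulrA; congr (_ * _).
rewrite psi_trD [Psi (Z x0)]psi_tr_anti ?mulr1; last exact: orbit_param_anti.
have -> : g^-1 = h^-1 * t^-1 by rewrite /t invfM invrK mulKf.
rewrite (tcharM hchi); try exact: torusV.
congr (_ * _); rewrite psi_trN -chiE //.
have c0 : chi t != 0.
  by apply/eqP => c0; have := chi_mulV ht; rewrite c0 mul0r => /esym/eqP; rewrite oner_eq0.
by apply: (mulfI c0); rewrite mulfV // chi_mulV.
Qed.

Lemma torus_average_outside y : (forall g, torus tau g -> ~ B (y - g * x0)) -> Phi y = 0.
Proof.
move=> hy; have [us st sc si] := (torus_repsE j s).1 hs.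
apply: big1_seq => g /andP[_ gs]; rewrite deltaE asboolF ?mulr0 //.
by apply: hy; apply: st.
Qed.

Lemma torus_orbitP y : (exists g b, [/\ torus tau g, B b & y = g * x0 + b]) \/
  (forall g, torus tau g -> ~ B (y - g * x0)).
Proof.
have [[g [hg Bg]]|h] := pselect (exists g, torus tau g /\ B (y - g * x0)).
  by left; exists g, (y - g * x0); split=> //; rewrite addrC subrK.
by right=> g hg Bg; apply: h; exists g.
Qed.

Lemma torus_average_weight : weight chi Phi.
Proof.
have [us st sc si] := (torus_repsE j s).1 hs.
split; first split.
- move=> b y Bb; rewrite psi_half_beta.
  case: (torus_orbitP y) => [[g [b' [hg Bb' ->]]]|hy].
    have -> : b + (g * x0 + b') = g * x0 + (b' + b) by ring.
    rewrite !torus_average_orbit //; last exact: vgeD.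
    have -> : u * tau (g * x0) * (b' + b) / 4%:R =
      u * tau (g * x0) * b' / 4%:R + u * tau (g * x0) * b / 4%:R by ring.
    have -> : u * tau (g * x0 + b') * b / 4%:R =
      u * tau (g * x0) * b / 4%:R + u * tau b' * b / 4%:R by rewrite linearD /=; ring.
    by rewrite !psi_trD (beta_trivial Bb' Bb) mulr1; ring.
  rewrite !torus_average_outside ?mulr0 // => g hg Bg; apply: (hy g hg).
  by have -> : y - g * x0 = b + y - g * x0 - b by [ring]; apply: vgeB.
- apply: (lattice_model_summable (c := [seq g * x0 | g <- s])) => y py.
  case: (torus_orbitP y) => [[g [b [hg Bb yE]]]|hy]; last first.
    by rewrite torus_average_outside // eqxx in py.
  have [h h_s gh] := sc g hg; exists (h * x0); first by apply/mapP; exists h.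
  have -> : y - h * x0 = (g - h) * x0 + b by rewrite yE; ring.
  by apply: vgeD => //; apply/lattice_orbit; apply: vgeBC.
move=> h hh y; rewrite /weil_act; have [h0 _] := val_torus hh.
case: (torus_orbitP y) => [[g [b [hg Bb ->]]]|hy]; last first.
  rewrite !torus_average_outside ?mulr0 // => g hg Bg.
  apply: (hy (h * g)); first exact: torusM.
  have -> : y - h * g * x0 = h * (h^-1 * y - g * x0) by field.
  exact/vge_torus.
have -> : h^-1 * (g * x0 + b) = (h^-1 * g) * x0 + h^-1 * b by ring.
have hV := torusV hh.
rewrite !torus_average_orbit //; [|exact: torusM|exact/vge_torus].
have [g0 _] := val_torus hg.
have -> : (h^-1 * g)^-1 = h * g^-1 by rewrite invfM invrK.
rewrite (tcharM hchi) //; last exact: torusV.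
rewrite -mulrA; congr (_ * (_ * Psi _)).
by rewrite !tauM -(torus_inv hV) invrK; field; rewrite four_neq0 h0.
Qed.

Lemma torus_average_x0 : Phi x0 = 1.
Proof.
have := torus_average_orbit torus1 (vge0 w m); rewrite mul1r addr0 => ->.
by rewrite invr1 (tchar1 hchi) mulr0 mul0r psi_tr0 mulr1.
Qed.

Lemma weight_space_average : weight chi = cline Phi.
Proof.
apply/seteqP; split=> phi; last first.
  move=> [c _ <-]; have [[h1 h2] h3] := torus_average_weight; split; last first.
    by move=> g hg y; have := h3 g hg y; rewrite /weil_act => ->; rewrite mulrCA.
  split=> [b y Bb|]; first by rewrite h1 // mulrCA.
  have [us st sc si] := (torus_repsE j s).1 hs.
  apply: (@lattice_model_summable (fun y => c * Phi y) [seq g * x0 | g <- s]) => y py.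
  case: (torus_orbitP y) => [[g [b [hg Bb yE]]]|hy]; last first.
    by rewrite torus_average_outside // mulr0 eqxx in py.
  have [h h_s gh] := sc g hg; exists (h * x0); first by apply/mapP; exists h.
  have -> : y - h * x0 = (g - h) * x0 + b by rewrite yE; ring.
  by apply: vgeD => //; apply/lattice_orbit; apply: vgeBC.
move=> hphi; exists (phi x0) => //; apply: funext => y.
case: (torus_orbitP y) => [[g [b [hg Bb ->]]]|hy].
  rewrite torus_average_orbit // [in RHS]addrC (lattice_modelB _ hphi.1 Bb).
  have := hphi.2 _ (torusV hg) x0; rewrite /weil_act invrK => ->; ring.
(* Off the orbit of [x0 + B], a nonzero value at [y] would give [chi] a conductor [2 j'], hence
   [j' = j]. Then [Z y] and [Z x0] define the same character of [T_j], which puts [y] in the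
   orbit. *)
rewrite torus_average_outside // mulr0; apply/esym/eqP/negP => /negP py.
have cond := orbit_conductor j_gt0 x0_neq0 val_x0 chiE.
have nBy : ~ B y.
  move=> By; have := cond.2 0%N; rewrite leqn0 muln_eq0 /= => h.
  have /eqP : j == 0%N by apply: h => t /torus_subE[ht _]; exact: weight_lattice_trivial py By ht.
  lia.
have [j' [j'0 y0 wy hy']] := weight_support hphi py nBy.
have /eqP := char_conductor_uniq cond (orbit_conductor j'0 y0 wy hy').
rewrite eqn_pmul2l // => /eqP jj; rewrite -jj in j'0 wy hy'.
have [|g hg] := orbit_param_close j_gt0 y0 x0_neq0 wy val_x0; last exact: hy.
apply: anti_char_close => //; try exact: orbit_param_anti.
by move=> t ht tj; rewrite -chiE // -hy'.
Qed.

End WeightVector.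

Lemma weight_spannedP (chi : L -> R[i]) (j : nat) c a : torus_char tau w chi ->
  (0 < j)%N -> c * a != 0 -> w (c * a) = m - j%:Z ->
  (forall t, torus tau t -> vge w j%:Z (t - 1) -> chi t = Psi (Z (c * a) * t)) ->
  weight_spanned tau w pi2 psi beta B chi j c a /\ occurs tau psi beta B chi.
Proof.
move=> hchi j0 ca0 wca hca.
have phiE s : phi_chi psi beta B chi s c a = torus_average chi (c * a) s.
  by apply: funext => y; apply: eq_bigr => g _; rewrite -[c * g * a]mulrA mulrCA.
have [s hs] := torus_reps_exists j.
split; first split; first by exists s.
  by move=> s' hs'; rewrite phiE; exact: weight_space_average hs'.
exists (torus_average chi (c * a) s); first exact: torus_average_weight hs.
by exists (c * a); rewrite (torus_average_x0 _ _ _ _ _ hs) // oner_neq0.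
Qed.

(** * Finite duality for [T_j / T_2j] *)

Lemma anti_finite (i j : int) : exists s : seq L, [/\ uniq s,
  forall x, x \in s -> tau x = - x /\ vge w i x,
  forall x, tau x = - x -> vge w i x -> exists2 y, y \in s & vge w j (y - x) &
  forall x y, x \in s -> y \in s -> vge w j (x - y) -> x = y].
Proof.
have [c hc] := netsL i j.
have [||||s [us sA scov sinj]] := @finite_reps L
  [set x | tau x = - x /\ vge w i x] (fun x y => vge w j (x - y))
  (fun y x => vge w j (x - y)) c.
- by move=> x _; rewrite subrr; left.
- by move=> x y _ _; apply: vgeBC.
- by move=> x [_ xi]; apply: hc => //; apply: memvf.
- by move=> y x x' _ _ xy x'y; apply: (vgeBD hw (y := y)) => //; apply: vgeBC.
by exists s; split=> // t ht ti; apply: scov.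
Qed.

(** Non-degeneracy on the torus side. The anti-invariant [s = t - tau t] has the valuation of
    [t - 1], since [t + 1] is a unit. If this is below [2 j], then [y = 2 x / s] with [Psi x != 1]
    is an admissible anti-invariant element and [Psi (y * t) = Psi x]. *)
Lemma torus_char_detect (j : nat) t : (0 < j)%N -> torus tau t -> vge w j%:Z (t - 1) ->
  (forall x, tau x = - x -> vge w (D - (2 * j)%:Z) x -> Psi (x * t) = 1) ->
  vge w (2 * j)%:Z (t - 1).
Proof.
move=> j0 ht tj h; apply: contrapT => nt.
have t10 : t - 1 != 0 by apply: contra_notN nt => /eqP ->; left.
have wt1 : w (t - 1) < (2 * j)%:Z by move: nt; rewrite vgeE // => /negP; rewrite -ltNge.
have [t0 wt] := val_torus ht.
have [p0 wp] : t + 1 != 0 /\ w (t + 1) = 0.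
  have -> : t + 1 = 2%:R + (t - 1) by ring.
  rewrite -[in X in _ /\ _ = X]val2; apply: valuationDl => //.
  by rewrite val2 add0r; apply: vge_le tj; lia.
pose s := t - tau t.
have sE : s = t^-1 * (t - 1) * (t + 1) by rewrite /s -(torus_inv ht); field.
have s0 : s != 0 by rewrite sE !mulf_neq0 ?invr_neq0.
have ws : w s = w (t - 1).
  rewrite sE !(Defs.valM hw) ?mulf_neq0 ?invr_neq0 // valuationV // wt wp.
  by rewrite oppr0 add0r addr0.
have ts : tau s = - s by rewrite linearB /= tauK opprB.
have [x [xK xD /eqP[]]] := psi_tr_nontrivial.
pose y := 2%:R * x / s.
have ty : tau y = - y by rewrite /y !tauM tauV ts tau_nat (tau_id xK) invrN mulrN.
have yD : vge w (D - (2 * j)%:Z) y.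
  rewrite /y -mulrA; apply: vgeMl => //; first by right; rewrite val2.
  apply: (vge_le (n := D - 1 - w s)); first by rewrite ws; lia.
  by apply: vgeM => //; right; rewrite valuationV.
have -> : x = y * s / 2%:R by rewrite /y divfK // mulrC mulKf.
clearbody y; have -> : y * s / 2%:R = y * t - y * (t + tau t) / 2%:R.
  by rewrite /s; field.
rewrite psi_trD h //.
rewrite mul1r psi_tr_anti // linearN /= !tauM tauV [tau (t + _)]linearD /= tauK ty tau_nat.
by rewrite [tau t + t]addrC !mulNr.
Qed.

(* Pontryagin duality between [T_j / T_2j] and the anti-invariant elements, obtained by
   summing [chi t * Psi (x * t)] over both quotients. *)
Lemma torus_char_param (chi : L -> R[i]) (j : nat) : torus_char tau w chi -> (0 < j)%N ->
  (forall t, torus tau t -> vge w (2 * j)%:Z (t - 1) -> chi t = 1) ->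
  exists z, [/\ tau z = - z, vge w (D - (2 * j)%:Z) z &
    forall t, torus tau t -> vge w j%:Z (t - 1) -> chi t = Psi (z * t)].
Proof.
move=> hchi j0 chi1.
(* For [t] in [T_j], [Psi (x * t)] depends only on [x] modulo exponent [D - j]; exponent [D - 2 j]
   of [x] makes it trivial on [T_2j]. *)
have [sX [uX AX covX injX]] := anti_finite (D - (2 * j)%:Z) (D - j%:Z).
have [sT [uT AT covT injT]] := torus_finite j (2 * j).
pose f x t := chi t * Psi (x * t).
have sumX t : t \in sT -> ~ vge w (2 * j)%:Z (t - 1) -> \sum_(x <- sX) f x t = 0.
  move=> tT nt; have [ht tj] := AT _ tT.
  have [x1 [tx1 x1D px1]] : exists x, [/\ tau x = - x, vge w (D - (2 * j)%:Z) x &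
      Psi (x * t) != 1].
    apply: contrapT => h; apply: nt; apply: torus_char_detect => // x tx xD.
    by apply/eqP/negP => /negP px; apply: h; exists x.
  have rep x : exists y, x \in sX -> y \in sX /\ vge w (D - j%:Z) (y - (x + x1)).
    have [xX|] := boolP (x \in sX); last by move=> _; exists 0.
    have [tx xD] := AX _ xX.
    have [||y yX yx] := covX (x + x1).
    - by rewrite linearD /= tx tx1 opprD.
    - exact: vgeD.
    by exists y.
  have [sigma hsigma] := choice rep.
  apply: (sum_shift_eq0 (sigma := sigma) uX _ _ _ px1).
  - by move=> x /hsigma[].
  - move=> x y xX yX sxy; apply: injX => //.
    have -> : x - y = (x + x1) - (y + x1) by ring.
    apply: (vgeBD hw (y := sigma x)); first exact/vgeBC/(hsigma _ xX).2.
    by rewrite sxy; exact: (hsigma _ yX).2.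
  move=> x xX; have [sX1 sx] := hsigma _ xX; have [tx _] := AX _ xX; have [ts _] := AX _ sX1.
  rewrite /f mulrCA; congr (_ * _); rewrite -psi_trD -mulrDl.
  have tsx : tau (sigma x - (x + x1)) = - (sigma x - (x + x1)).
    by rewrite linearB linearD /= ts tx tx1; ring.
  have -> : sigma x * t = (sigma x - (x + x1)) * t + (x1 + x) * t by ring.
  by rewrite psi_trD (anti_char_trivial tsx sx tj) mul1r.
have sumT x : x \in sX -> \sum_(t <- sT) f x t != 0 ->
    forall t, torus tau t -> vge w j%:Z (t - 1) -> f x t = 1.
  move=> xX nz t1 ht1 t1j; apply/eqP; apply: contraNT nz => ft1.
  have [tx xD] := AX _ xX.
  have trivPsi t t' : torus tau t -> torus tau t' -> vge w (2 * j)%:Z (t - t') ->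
      f x t = f x t'.
    move=> ht ht' tt'; have [t0 _] := val_torus ht; have [t'0 _] := val_torus ht'.
    have hq : torus tau (t'^-1 * t) by apply: torusM => //; apply: torusV.
    have ct : chi t = chi t'.
      rewrite -[t](mulVKf t'0) (tcharM hchi) // [chi (_ * t)]chi1 ?mulr1 //.
      exact/vge_divr_torus.
    rewrite /f ct.
    congr (_ * _); have -> : x * t = x * t' + x * (t - t') by ring.
    rewrite psi_trD [X in _ * X]psi_tr_trivial ?mulr1 //.
    have -> : D = (D - (2 * j)%:Z) + (2 * j)%:Z by rewrite subrK.
    exact: vgeM.
  have rep t : exists y, t \in sT -> y \in sT /\ vge w (2 * j)%:Z (y - t1 * t).
    have [tT|] := boolP (t \in sT); last by move=> _; exists 0.
    have [ht tj] := AT _ tT.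
    have [||y yT yt] := covT (t1 * t); first exact: torusM.
    - have -> : t1 * t - 1 = t1 * (t - 1) + (t1 - 1) by ring.
      by apply: vgeD => //; apply/vge_torus.
    by exists y.
  have [sigma hsigma] := choice rep.
  apply/eqP; apply: (sum_shift_eq0 (sigma := sigma) uT _ _ _ ft1).
  - by move=> t /hsigma[].
  - move=> t t' tT t'T stt; apply: injT => //; apply/(vge_torus _ _ ht1).
    have -> : t1 * (t - t') = t1 * t - t1 * t' by ring.
    apply: (vgeBD hw (y := sigma t)); first exact/vgeBC/(hsigma _ tT).2.
    by rewrite stt; exact: (hsigma _ t'T).2.
  move=> t tT; have [sT1 st] := hsigma _ tT; have [ht tj] := AT _ tT.
  have [hst _] := AT _ sT1.
  rewrite (trivPsi _ _ hst _ st); last exact: torusM.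
  rewrite /f (tcharM hchi) // mulrACA; congr (_ * _); rewrite -psi_trD.
  (* The cross term has exponent [D], so [t |-> Psi (x * t)] is multiplicative on [T_j]. *)
  have -> : x * (t1 * t) = x * t1 + x * t - x + x * ((t1 - 1) * (t - 1)) by ring.
  rewrite [LHS]psi_trD [Psi (x * ((t1 - 1) * _))]psi_tr_trivial ?mulr1; last first.
    have -> : D = (D - (2 * j)%:Z) + (j%:Z + j%:Z) by rewrite mul2n -addnn PoszD subrK.
    by apply: vgeM => //; apply: vgeM.
  by rewrite [LHS]psi_trD psi_trN [Psi x]psi_tr_anti // invr1 mulr1.
(* If every sum over [t] vanished, so would the double sum. Summed over [x] first, only the class of
   [1] survives, and it contributes the positive number of elements of [sX]. *)
have [x xX nz] : exists2 x, x \in sX & \sum_(t <- sT) f x t != 0.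
  apply: contrapT => h.
  have : \sum_(x <- sX) \sum_(t <- sT) f x t = 0.
    apply: big1_seq => x /andP[_ xX]; apply/eqP/negP => /negP nz.
    by apply: h; exists x.
  rewrite exchange_big /=.
  have [||t0 t0T t01] := covT 1; first exact: torus1.
    by rewrite subrr; left.
  rewrite (bigD1_seq t0) //= [X in _ + X]big1_seq ?addr0; last first.
    move=> t /andP[tt0 tT]; apply: sumX => // t1; case/eqP: tt0; apply: injT => //.
    by apply: (vgeBD hw t1); apply: vgeBC.
  have [ht0 _] := AT _ t0T.
  have -> : \sum_(x <- sX) f x t0 = \sum_(x <- sX) 1.
    apply: eq_big_seq => x /AX[tx xD]; rewrite /f chi1 // mul1r.
    exact: anti_char_trivial xD _.
  rewrite big_const_seq count_predT iter_addr_0 => /eqP; rewrite pnatr_eq0 size_eq0.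
  have [||y yX _] := covX 0; first by rewrite linear0 oppr0.
    by left.
  by move=> /eqP sX0; rewrite sX0 in yX.
have [tx xD] := AX _ xX.
exists (- x); split; first by rewrite linearN /= tx.
  exact: vgeN.
move=> t ht tj; have := sumT x xX nz t ht tj; rewrite /f mulNr psi_trN => fx.
by apply: (mulIf (psi_tr_neq0 (x * t))); rewrite fx mulVf // psi_tr_neq0.
Qed.

(** A larger valuation of [z] would make [chi] trivial on [T_(2j-1)], against the minimality of the
    conductor. *)
Lemma torus_char_param_exact (chi : L -> R[i]) (j : nat) : torus_char tau w chi ->
  (0 < j)%N -> char_conductor tau w pi2 chi (2 * j) ->
  exists z, [/\ tau z = - z, z != 0, w z = D - (2 * j)%:Z &
    forall t, torus tau t -> vge w j%:Z (t - 1) -> chi t = Psi (z * t)].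
Proof.
move=> hchi j0 [c1 c2]; have [|z [tz zD hz]] := torus_char_param hchi j0.
  by move=> t ht tj; apply: c1; apply/torus_subE.
have nz : ~ vge w (D - (2 * j).-1%:Z) z.
  move=> h; have : (2 * j <= (2 * j).-1)%N; last by lia.
  apply: c2 => t /torus_subE[ht tj]; rewrite hz //; last by apply: vge_le tj; lia.
  exact: anti_char_trivial h tj.
have z0 : z != 0 by apply: contra_notN nz => /eqP ->; left.
by exists z; split=> //; move: nz zD; rewrite !vgeE //; lia.
Qed.

(** * Norms of units *)

(* Pigeonhole in the residue field: the classes of the squares and of the
   [c + u0 ^ 2 * y ^ 2] are too many to be disjoint. *)
Lemma residue_norm u0 c : tau u0 = - u0 -> u0 != 0 -> w u0 = 0 ->
  c \in K -> vge w 0 c ->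
  exists x y, [/\ x \in K, y \in K & vge w 1 (x ^+ 2 - u0 ^+ 2 * y ^+ 2 - c)].
Proof.
move=> tu0 u00 wu0 cK c0.
have [cn hcn] := netsL 0 1.
have [||||s [us sA scov sinj]] := @finite_reps L
  [set x | x \in K /\ vge w 0 x] (fun x y => vge w 1 (x - y))
  (fun y x => vge w 1 (x - y)) cn.
- by move=> x _; rewrite subrr; left.
- by move=> x y _ _; apply: vgeBC.
- by move=> x [_ xi]; apply: hcn => //; apply: memvf.
- by move=> y x x' _ _ xy x'y; apply: (vgeBD hw (y := y)) => //; apply: vgeBC.
have d0K : u0 ^+ 2 \in K by apply: tau_fixed; rewrite expr2 tauM tu0 mulrNN.
have d00 : u0 ^+ 2 != 0 by rewrite expf_neq0.
have wd0 : w (u0 ^+ 2) = 0 by rewrite valuationXn // wu0 mulr0.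
have rep x : exists y, x \in K /\ vge w 0 x -> y \in s /\ vge w 1 (y - x).
  have [xA|nA] := pselect (x \in K /\ vge w 0 x); last by exists 0 => /nA.
  by have [y ys yx] := scov x xA; exists y.
have [rho hrho] := choice rep.
have rhoE x y : x \in K /\ vge w 0 x -> y \in K /\ vge w 0 y -> vge w 1 (x - y) ->
    rho x = rho y.
  move=> xA yA xy; have [xs rx] := hrho _ xA; have [ys ry] := hrho _ yA.
  by apply: sinj => //; apply: (vgeBD hw rx); apply: (vgeBD hw xy); apply: vgeBC.
have rhoI x y : x \in K /\ vge w 0 x -> y \in K /\ vge w 0 y -> rho x = rho y ->
    vge w 1 (x - y).
  move=> xA yA xy; have [xs rx] := hrho _ xA; have [ys ry] := hrho _ yA.
  by apply: (vgeBD hw (y := rho x)); [apply: vgeBC|rewrite xy].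
pose f1 x := rho (x ^+ 2); pose f2 x := rho (c + u0 ^+ 2 * x ^+ 2).
have sqA x : x \in s -> x ^+ 2 \in K /\ vge w 0 (x ^+ 2).
  by move=> /sA[xK x0]; split; [rewrite rpredX|rewrite expr2; apply: vgeMl].
have csqA x : x \in s -> c + u0 ^+ 2 * x ^+ 2 \in K /\ vge w 0 (c + u0 ^+ 2 * x ^+ 2).
  move=> /sqA[xK x0]; split; first by rewrite rpredD // rpredM.
  by apply: vgeD => //; apply: vgeMl => //; right; rewrite wd0.
have [[x [y [xs ys /rhoI h]]]|disj] := pselect (exists x y, [/\ x \in s, y \in s & f1 x = f2 y]).
  have [xK _] := sA _ xs; have [yK _] := sA _ ys.
  exists x, y; split=> //; have := h (sqA _ xs) (csqA _ ys).
  by have -> : x ^+ 2 - (c + u0 ^+ 2 * y ^+ 2) = x ^+ 2 - u0 ^+ 2 * y ^+ 2 - c by ring.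
have oppA x : x \in s -> - x \in K /\ vge w 0 (- x).
  by move=> /sA[xK x0]; split; [rewrite rpredN|apply: vgeN].
(* Modulo the maximal ideal a square has only the roots [y] and [- y], so [f1] and [f2] take each
   value at most twice. *)
have sqr_eq x y : x \in s -> y \in s -> vge w 1 (x ^+ 2 - y ^+ 2) ->
    x \in [:: y; rho (- y)].
  move=> xs ys; have [xK x0] := sA _ xs; have [yK y0] := sA _ ys.
  rewrite subr_sqr => /(vgeM_prime hw)[||h|h]; [exact: vgeB|exact: vgeD| |].
    by rewrite inE (sinj x y) ?eqxx.
  have [rs ry] := hrho _ (oppA _ ys); rewrite !inE (sinj x (rho (- y))) ?eqxx ?orbT //.
  apply: (vgeBD hw (y := - y)); first by rewrite opprK.
  exact: vgeBC.
have fiber (f : L -> L) y : (forall x x', x \in s -> x' \in s -> f x = f x' ->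
    vge w 1 (x ^+ 2 - x' ^+ 2)) -> (count_mem y (map f s) <= 2)%N.
  move=> hf; rewrite count_map -size_filter; set l := seq.filter _ s.
  case El : l => [//|x1 l']; rewrite -El.
  have lP x : x \in l -> f x = y /\ x \in s.
    by rewrite mem_filter => /andP[/eqP].
  have [fx1 x1s] : f x1 = y /\ x1 \in s by apply: lP; rewrite El mem_head.
  apply: (@uniq_leq_size _ l [:: x1; rho (- x1)]); first exact: filter_uniq.
  by move=> x /lP[fx xs]; apply: sqr_eq => //; apply: hf => //; rewrite fx fx1.
have f1P x x' : x \in s -> x' \in s -> f1 x = f1 x' -> vge w 1 (x ^+ 2 - x' ^+ 2).
  by move=> xs x's; apply: rhoI; apply: sqA.
have f2P x x' : x \in s -> x' \in s -> f2 x = f2 x' -> vge w 1 (x ^+ 2 - x' ^+ 2).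
  move=> xs x's /rhoI h; apply/(vgeM_unit hw _ _ d00 wd0).
  have := h (csqA _ xs) (csqA _ x's).
  suff -> : c + u0 ^+ 2 * x ^+ 2 - (c + u0 ^+ 2 * x' ^+ 2) = u0 ^+ 2 * (x ^+ 2 - x' ^+ 2) by [].
  by ring.
pose l := map f1 s ++ map f2 s.
have l_s : {subset l <= s}.
  move=> y; rewrite mem_cat => /orP[] /mapP[x xs ->].
    by case: (hrho _ (sqA _ xs)).
  by case: (hrho _ (csqA _ xs)).
have A0 : 0 \in K /\ vge w 0 0 by split; [rewrite mem0v|left].
have [z0s rz0] := hrho _ A0; set z0 := rho 0 in z0s rz0.
rewrite subr0 in rz0.
have z0f1 : f1 z0 = z0.
  by apply: rhoE => //; [exact: sqA|rewrite subr0 expr2; apply: vgeMl => //; apply: vge_le rz0].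
have count_l y : (count_mem y l <= 2)%N.
  rewrite count_cat.
  have [/mapP[x xs yx]|/count_memPn ->] := boolP (y \in map f1 s); last first.
    exact: fiber.
  have /count_memPn -> : y \notin map f2 s.
    by apply/mapP => -[x' x's yx']; apply: disj; exists x, x'; rewrite -yx -yx'.
  by rewrite addn0; apply: fiber.
(* The class of [0] is the square of [0] only and, by disjointness, is no value of [f2]. This defect
   of one makes [2 q] values too many for [q] classes, each taken at most twice. *)
have count_z0 : (count_mem z0 l <= 1)%N.
  rewrite count_cat.
  have /count_memPn -> : z0 \notin map f2 s.
    by apply/mapP => -[x' x's zx']; apply: disj; exists z0, x'; rewrite z0f1 -zx'.
  rewrite addn0 count_map -size_filter.
  apply: (@uniq_leq_size _ _ [:: z0]); first exact: filter_uniq.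
  move=> x; rewrite mem_filter inE => /andP[/eqP fx xs].
  have [xK x0] := sA _ xs.
  have x2 : vge w 1 (x * x).
    by have := rhoI _ _ (sqA _ xs) A0 fx; rewrite subr0 expr2.
  apply/eqP; apply: sinj => //; apply: vgeB => //.
  by case: (vgeM_prime hw x0 x0 x2).
have := count_mem_sum us l_s; rewrite size_cat !size_map (bigD1_seq z0) //=.
have : (\sum_(y <- s | y != z0) count_mem y l <= \sum_(y <- s | y != z0) 2)%N.
  by apply: leq_sum => y _; apply: count_l.
have : (\sum_(y <- s) 2 = 2 + \sum_(y <- s | y != z0) 2)%N by rewrite (bigD1_seq z0).
rewrite big_const_seq count_predT iter_addn_0.
have absurd_count (a b d q : nat) :
    (a <= 1 -> 2 * q = 2 + d -> b <= d -> a + b = q + q -> False)%N by clear; lia.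
by move=> h1 h2 h3; case: (absurd_count _ _ _ _ count_z0 h1 h2 h3).
Qed.

(** A solution modulo the maximal ideal has norm [c] up to a principal unit of [K], and that unit is
    [d ^+ 2], the norm of some [d] in [K]. *)
Lemma norm_surj u0 c : tau u0 = - u0 -> u0 != 0 -> w u0 = 0 ->
  c \in K -> c != 0 -> w c = 0 -> exists a, [/\ a != 0, w a = 0 & a * tau a = c].
Proof.
move=> tu0 u00 wu0 cK c0 wc.
have [|x [y [xK yK xy]]] := residue_norm tu0 u00 wu0 cK; first by right; rewrite wc.
pose a := x + y * u0.
have Na : a * tau a = x ^+ 2 - u0 ^+ 2 * y ^+ 2.
  by rewrite /a linearD /= tauM tu0 (tau_id xK) (tau_id yK); ring.
have [N0 wN] : a * tau a != 0 /\ w (a * tau a) = w c.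
  have -> : a * tau a = c + (a * tau a - c) by ring.
  by apply: valuationDl; rewrite // wc add0r Na.
have a0 : a != 0 by apply: contraNneq N0 => ->; rewrite mul0r.
have wa : w a = 0.
  move: wN; rewrite (Defs.valM hw) ?tau_eq0 // val_tau // wc => /eqP.
  by rewrite -mulr2n mulrn_eq0 => /eqP.
have cNK : c / (a * tau a) \in K.
  by apply: tau_fixed; rewrite tauM tauV tauM tauK (tau_id cK) [tau a * a]mulrC.
have [|d [dK dc d1]] := sqrt_of_1unit hw two_neq0 val2 completeK cNK.
  have -> : c / (a * tau a) - 1 = - ((a * tau a)^-1 * (a * tau a - c)).
    by rewrite mulrBr mulVf // opprB mulrC.
  apply: vgeN => //; rewrite Na; apply: vgeMl => //; rewrite -Na.
  by right; rewrite valuationV // wN wc.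
have [d0 wd] : d != 0 /\ w d = 0.
  by have := unit_1D hw d1; rewrite addrC subrK.
exists (a * d); split; first by rewrite mulf_neq0.
  by rewrite (Defs.valM hw) // wa wd.
by rewrite tauM (tau_id dK) mulrACA -expr2 dc mulrC divfK.
Qed.

(** * The weights in the unramified and ramified cases *)

Lemma orbit_formula c a y t : c * tau c = y ->
  psi (- 4%:R^-1 * ext_trace (y * (a * tau a) * u * t)) = Psi (Z (c * a) * t).
Proof.
move=> cy; rewrite mulNr -mulrN -ext_traceN psi_quarter -cy /Z tauM.
by congr Psi; ring.
Qed.

Lemma occurs_param chi : nontrivial_char tau chi -> occurs tau psi beta B chi ->
  exists (j : nat) a, [/\ (0 < j)%N, int_units w a,
    char_conductor tau w pi2 chi (2 * j) &
    forall t, torus tau t -> vge w j%:Z (t - 1) ->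
      chi t = Psi (Z (pi2 ^ (m - j%:Z) * a) * t)].
Proof.
move=> [t1 ht1 ct1] [phi hphi [x px]].
have nBx : ~ B x.
  by move=> Bx; case/eqP: ct1; exact: weight_lattice_trivial hphi px Bx ht1.
have [j [j0 x0 wx hx]] := weight_support hphi px nBx.
have [p0 wp] := hpi2.
have c0 : pi2 ^ (m - j%:Z) != 0 by rewrite expfz_neq0.
exists j, (x / pi2 ^ (m - j%:Z)); rewrite [_ * (x / _)]mulrC divfK //; split=> //.
  split; first by rewrite mulf_neq0 // invr_neq0.
  by rewrite (Defs.valM hw) ?invr_neq0 // valuationV // valuationXz // wx wp mulr1 subrr.
exact: orbit_conductor hx.
Qed.

Lemma unit_spanned (chi : L -> R[i]) (j : nat) a : torus_char tau w chi ->
  (0 < j)%N -> int_units w a ->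
  (forall t, torus tau t -> vge w j%:Z (t - 1) ->
    chi t = Psi (Z (pi2 ^ (m - j%:Z) * a) * t)) ->
  weight_spanned tau w pi2 psi beta B chi j (pi2 ^ (m - j%:Z)) a /\
  occurs tau psi beta B chi.
Proof.
move=> hchi j0 [a0 wa] h; have [p0 wp] := hpi2.
apply: weight_spannedP => //; first by rewrite mulf_neq0 // expfz_neq0.
by rewrite (Defs.valM hw) ?expfz_neq0 // valuationXz // wp wa mulr1 addr0.
Qed.

Lemma conductor_gt0 (chi : L -> R[i]) n : nontrivial_char tau chi ->
  char_conductor tau w pi2 chi n -> (0 < n)%N.
Proof.
move=> [t ht ct] [c1 _]; rewrite lt0n; apply: contraNneq ct => n0.
rewrite c1 // n0; apply/torus_subE; split=> //.
by apply: vgeB => //; [right; rewrite (val_torus ht).2|exact: vge1].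
Qed.

Lemma unramified_weights : tau pi2 = pi2 ->
  (forall chi : L -> R[i], torus_char tau w chi -> nontrivial_char tau chi ->
    (occurs tau psi beta B chi <->
     exists2 n : nat, char_conductor tau w pi2 chi n & ~~ odd n)) /\
  (forall (chi : L -> R[i]) (j : nat), torus_char tau w chi ->
    (0 < j)%N -> char_conductor tau w pi2 chi (2 * j) ->
    let formula (a : L) := forall t, torus_sub tau w pi2 j t ->
      chi t = psi (- 4%:R^-1 *
        ext_trace (pi2 ^ (m + m - (2 * j)%:Z) * (a * tau a) * u * t)) in
    (exists2 a, int_units w a & formula a) /\
    (forall a, int_units w a -> formula a ->
      weight_spanned tau w pi2 psi beta B chi j (pi2 ^ (m - j%:Z)) a)).
Proof.
move=> tpi2; have [p0 wp] := hpi2.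
have tX n : tau (pi2 ^ n) = pi2 ^ n by rewrite (tauXz tauM tau_id tau_u quad) tpi2.
have cc (j : nat) : pi2 ^ (m - j%:Z) * tau (pi2 ^ (m - j%:Z)) = pi2 ^ (m + m - (2 * j)%:Z).
  rewrite tX -expfzDr //; congr (_ ^ _).
  by rewrite mul2n -addnn PoszD opprD addrACA.
have exist (chi : L -> R[i]) (j : nat) : torus_char tau w chi -> (0 < j)%N ->
    char_conductor tau w pi2 chi (2 * j) -> exists2 a, int_units w a &
    forall t, torus tau t -> vge w j%:Z (t - 1) ->
      chi t = Psi (Z (pi2 ^ (m - j%:Z) * a) * t).
  move=> hchi j0 hc; have [z [tz z0 wz hz]] := torus_char_param_exact hchi j0 hc.
  set c := pi2 ^ (m - j%:Z) in cc *.
  have c0 : c != 0 by rewrite expfz_neq0.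
  have tc : tau c = c by exact: tX.
  have wc : w c = m - j%:Z by rewrite valuationXz // wp mulr1.
  (* The equation [Z (c * a) = z] amounts to [a * tau a = b], and [b] is a unit because
     [w z = D - 2 j]. *)
  pose b := - (z * 4%:R / (u * (c * c))).
  have cc0 : u * (c * c) != 0 by rewrite !mulf_neq0.
  (* As [tau] fixes [pi2], the element [u * pi2 ^ (- w u)] is an anti-invariant unit, as the
     surjectivity of the norm requires. *)
  have [||||||a [a0 wa Na]] := @norm_surj (u * pi2 ^ (- w u)) b; last first.
  - exists a => // t ht tj; rewrite hz //; congr (Psi (_ * t)).
    rewrite /Z tauM tc.
    have -> : c * a * (c * tau a) = c * c * (a * tau a) by ring.
    rewrite Na /b; field; rewrite four_neq0 u_neq0 c0 //.
  - rewrite valuationN // !(Defs.valM hw) ?mulf_neq0 ?four_neq0 ?invr_neq0 //.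
    rewrite valuationV // !(Defs.valM hw) ?mulf_neq0 // val4 wz wc /D.
    by rewrite mul2n -addnn PoszD; ring.
  - by rewrite oppr_eq0 !mulf_neq0 ?four_neq0 ?invr_neq0.
  - apply: tau_fixed; rewrite /b linearN /= !tauM tauV !tauM tz tau_nat tau_u tc.
    by rewrite !mulNr invrN mulrN opprK.
  - by rewrite (Defs.valM hw) ?expfz_neq0 // valuationXz // wp mulr1 subrr.
  - by rewrite mulf_neq0 // expfz_neq0.
  by rewrite tauM tX tau_u mulNr.
split=> [chi hchi nchi|chi j hchi j0 hc formula].
  split=> [hocc|[n hn nodd]].
    have [j [a [_ _ hc _]]] := occurs_param nchi hocc.
    by exists (2 * j)%N => //; rewrite oddM.
  have nE : n = (2 * n./2)%N by rewrite mul2n -[LHS]odd_double_half (negPf nodd).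
  have n0 := conductor_gt0 nchi hn; rewrite nE in hn.
  have j0 : (0 < n./2)%N by rewrite nE muln_gt0 in n0.
  have [a ha fa] := exist chi _ hchi j0 hn.
  by case: (unit_spanned hchi j0 ha fa).
split.
  have [a ha fa] := exist chi j hchi j0 hc; exists a => // t /torus_subE[ht tj].
  by rewrite (orbit_formula _ _ (cc j)) fa.
move=> a ha fa; case: (unit_spanned hchi j0 ha _) => // t ht tj.
by rewrite fa ?(orbit_formula _ _ (cc j)) //; apply/torus_subE.
Qed.

Lemma ramified_weights p1 : tau pi2 = - pi2 -> u = pi2 -> pi2 ^+ 2 = p1 ->
  forall chi : L -> R[i], torus_char tau w chi -> nontrivial_char tau chi ->
    let formula (j : nat) (a : L) := forall t, torus_sub tau w pi2 j t ->
      chi t = psi (- ((-1) ^ (j%:Z - m) / 4%:R) *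
        ext_trace (p1 ^ (m - j%:Z) * (a * tau a) * pi2 * t)) in
    (occurs tau psi beta B chi <->
     exists2 j : nat, char_conductor tau w pi2 chi (2 * j) &
       exists2 a, int_units w a & formula j a) /\
    (forall (j : nat) (a : L), char_conductor tau w pi2 chi (2 * j) ->
      int_units w a -> formula j a ->
      weight_spanned tau w pi2 psi beta B chi j (pi2 ^ (m - j%:Z)) a).
Proof.
move=> tpi2 upi2 p1E chi hchi nchi formula; have [p0 wp] := hpi2.
have N1z (l : int) : (-1) ^ (- l) = (-1) ^ l :> k by rewrite -exprz_inv invrN1.
(* Since [tau pi2 = - pi2], the norm of [pi2] is [- p1]: this is the origin of the sign in the
   formula. *)
have cc (j : nat) : pi2 ^ (m - j%:Z) * tau (pi2 ^ (m - j%:Z)) =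
    ((-1) ^ (j%:Z - m) : k) *: p1 ^ (m - j%:Z).
  rewrite (tauXz tauM tau_id tau_u quad) tpi2 -[j%:Z - m]opprB N1z.
  rewrite -expfzMl mulrN -expr2 p1E -mulN1r expfzMl.
  rewrite -mulr_algl; congr (_ * _).
  by rewrite -in_algE rmorphXz ?unitfE ?oppr_eq0 ?oner_eq0 //= scaleN1r.
have formulaE (j : nat) a t :
    psi (- ((-1) ^ (j%:Z - m) / 4%:R) *
      ext_trace (p1 ^ (m - j%:Z) * (a * tau a) * pi2 * t)) =
    Psi (Z (pi2 ^ (m - j%:Z) * a) * t).
  rewrite -(orbit_formula _ _ (cc j)) upi2; congr psi.
  by rewrite -!scalerAl ext_traceZ; ring.
have spanned (j : nat) a : char_conductor tau w pi2 chi (2 * j) ->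
    int_units w a -> formula j a ->
    weight_spanned tau w pi2 psi beta B chi j (pi2 ^ (m - j%:Z)) a /\
    occurs tau psi beta B chi.
  move=> hc ha fa; have := conductor_gt0 nchi hc; rewrite muln_gt0 /= => j0.
  apply: unit_spanned => // t ht tj.
  by rewrite fa ?formulaE //; apply/torus_subE.
split; last by move=> j a hc ha fa; case: (spanned j a hc ha fa).
split=> [hocc|[j hc [a ha fa]]]; last by case: (spanned j a hc ha fa).
have [j [a [j0 ha hc hfa]]] := occurs_param nchi hocc.
exists j => //; exists a => // t /torus_subE[ht tj].
by rewrite formulaE hfa.
Qed.

End LatticeModel.

(** * The different and the residue characteristic *)

(** The codifferent contains some [z] of valuation at most [- del], since otherwise [p ^ (del - 1)]
    would lie in the different. Hence it contains every element of exponent [- del], and scaling by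
    [pi ^ (- lam)] reduces to these. *)
Lemma different_trace (k : fieldType) (v : k -> int) (pi : k) (M : fieldExtType k)
    (w : M -> int) (p : M) (e del : nat) (lam : int) :
  normalized_valuation v -> uniformizer v pi ->
  normalized_valuation w -> uniformizer w p ->
  extends_valuation (in_alg M) v w e -> different v w = pideal w p del%:Z ->
  forall x, vge w (e%:Z * lam - del%:Z) x -> vge v lam (ext_trace x).
Proof.
move=> hv [pi0 vpi] hw hp [e0 hwv] hdel x xl; have [p0 wp] := hp.
have [z [z0 zdel zc]] : exists z, [/\ z != 0, w z <= - del%:Z & codifferent v w z].
  apply: contrapT => h.
  have : different v w (p ^ (del%:Z - 1)).
    move=> y yc; rewrite /integers; have [->|y0] := eqVneq y 0.
      by rewrite mulr0; left.
    have yd : - del%:Z + 1 <= w y.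
      by rewrite leNgt; apply/negP => yd; apply: h; exists y; split=> //; lia.
    by right; rewrite (Defs.valM hw) ?expfz_neq0 // valuationXz // wp; lia.
  by rewrite hdel pidealE // vgeE ?expfz_neq0 // valuationXz // wp; lia.
have hwv' c : c != 0 -> w c%:A = e%:Z * v c by exact: hwv.
pose x' := pi ^ (- lam) *: x.
have x'd : vge w (- del%:Z) x'.
  have pl : vge v (- lam) (pi ^ (- lam)) by right; rewrite valuationXz // vpi mulr1.
  by have := vgeZ hw hwv' pl xl; rewrite mulrN addrA addNr add0r.
have : integers v (ext_trace x').
  have -> : x' = z * (x' / z) by rewrite mulrC divfK.
  apply: zc; apply: (vge_le (n := - del%:Z - w z)); first lia.
  by apply: vgeM => //; right; rewrite valuationV.
rewrite /x' ext_traceZ => h.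
have -> : ext_trace x = pi ^ lam * (pi ^ (- lam) * ext_trace x).
  by rewrite mulrA -expfzDr // subrr expr0z mul1r.
by apply: vgeMr => //; right; rewrite valuationXz // vpi mulr1.
Qed.

Lemma residue_two (k : fieldType) (v : k -> int) (Fq : finFieldType) (res : k -> Fq)
    (p : nat) : normalized_valuation v -> residue_map v res -> p \in [pchar Fq] ->
  p != 2%N -> 2%:R != 0 :> k /\ v 2%:R = 0.
Proof.
move=> hv hres hp p2; have one0 : integers v 1 by exact: vge1.
have two0 : integers v 2%:R by rewrite -[2%:R]/(1 + 1); apply: vgeD.
have n2 : ~ vge v 1 2%:R.
  move=> /(res_ker hres two0); rewrite -[2%:R]/(1 + 1) (resD hres) // (res1 hres).
  move=> /eqP; rewrite -[1 + 1]/(2%:R) -(dvdn_pcharf hp) dvdn_prime2 ?(negPf p2) //.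
  by case/andP: hp.
have t0 : 2%:R != 0 :> k by apply: contra_notN n2 => /eqP ->; left.
split=> //; move: two0 n2; rewrite /integers !vgeE // => h /negP; lia.
Qed.

Theorem mainTheorem14
  (R : realType)
  (* the local field k *)
  (k : fieldType) (v : k -> int) (Fq : finFieldType) (res : k -> Fq) (p : nat)
  (hk : local_field0 v res) (hp : p \in [pchar Fq]) (hp2 : p != 2%N)
  (pi : k) (hpi : uniformizer v pi)
  (* the additive character *)
  (psi : k -> R[i]) (hpsi : unitary_add_char v psi)
  (lam : int) (hlam : add_conductor v pi psi lam)
  (* k'' = L, k' = the subfield K of L *)
  (L : fieldExtType k) (K : {subfield L}) (r : nat) (hr : \dim K = r)
  (hquad : \dim_K {:L} = 2%N)
  (tau : 'End(L)) (htau : kAut K {:L} tau) (htau1 : tau <> \1%VF)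
  (v1 : subvs_of K -> int) (hv1 : normalized_valuation v1)
  (e : nat) (he : extends_valuation (in_alg (subvs_of K)) v v1 e)
  (v2 : L -> int) (hv2 : normalized_valuation v2)
  (e2 : nat) (he2 : extends_valuation (@vsval k L K) v1 v2 e2)
  (pi1 : subvs_of K) (hpi1 : uniformizer v1 pi1)
  (pi2 : L) (hpi2 : uniformizer v2 pi2)
  (hpi2_ram : e2 <> 1%N -> pi2 ^+ 2 = vsval pi1)
  (hpi2_unram : e2 = 1%N -> pi2 = vsval pi1)
  (u : L) (hu0 : u != 0) (hu : u + tau u = 0)
  (hu_ram : e2 <> 1%N -> u = pi2)
  (hu_unram : e2 = 1%N -> v2 u = 0 \/ v2 u = 1)
  (del : nat) (hdel : different v v1 = pideal v1 pi1 del%:Z) :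
  let beta := beta_form tau u in
  let mu : int := e%:Z * lam - del%:Z - v2 u in
  let ramified := e2 != 1%N in
  let B := good_lattice v2 (vsval pi1) pi2 ramified mu in
  let T_ := torus_sub tau v2 pi2 in
  let conductor := @char_conductor R k L tau v2 pi2 in
  let weight := weight_space tau psi beta B in
  (* self-duality *)
  B = dual_lattice v pi lam beta B ->
  (* a *)
  ((exists w, delta psi beta B 0 w != 0) /\
   weight (fun=> 1) = cline (delta psi beta B 0)) /\
  (* b *)
  (~~ ramified ->
    (forall chi : L -> R[i], torus_char tau v2 chi -> nontrivial_char tau chi ->
      (occurs tau psi beta B chi <->
       exists2 n : nat, conductor chi n & ~~ odd n)) /\
    (forall (chi : L -> R[i]) (j : nat), torus_char tau v2 chi ->
      (0 < j)%N -> conductor chi (2 * j)%N ->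
      let formula (a : L) := forall t, T_ j t ->
        chi t = psi (- 4%:R^-1 *
          ext_trace (vsval pi1 ^ (mu - (2 * j)%:Z) * (a * tau a) * u * t)) in
      (exists2 a, int_units v2 a & formula a) /\
      (forall a, int_units v2 a -> formula a ->
        weight_spanned tau v2 pi2 psi beta B chi j
          (vsval pi1 ^ ((mu %/ 2)%Z - j%:Z)) a))) /\
  (* c *)
  (ramified ->
    forall chi : L -> R[i], torus_char tau v2 chi -> nontrivial_char tau chi ->
      let formula (j : nat) (a : L) := forall t, T_ j t ->
        chi t = psi (- ((-1) ^ (j%:Z - mu) / 4%:R) *
          ext_trace (vsval pi1 ^ (mu - j%:Z) * (a * tau a) * pi2 * t)) in
      (occurs tau psi beta B chi <->
       exists2 j : nat, conductor chi (2 * j)%N &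
         exists2 a, int_units v2 a & formula j a) /\
      (forall (j : nat) (a : L), conductor chi (2 * j)%N ->
        int_units v2 a -> formula j a ->
        weight_spanned tau v2 pi2 psi beta B chi j (pi2 ^ (mu - j%:Z)) a)).
Proof.
move=> beta mu ramified B T_ conductor weight hself.
have hv := lf_val hk.
have [two0 val2] := residue_two hv (lf_res hk) hp hp2.
have [e_gt0 hv1v] := he; have [e2_gt0 hv2v1] := he2.
have [/kHomP_tmp[tau_id tauM'] _] := andP htau.
have tauM : {morph tau : x y / x * y} by move=> x y; apply: tauM'; rewrite memvf.
have tau_u : tau u = - u by apply/eqP; rewrite -addr_eq0 addrC hu.
have E_gt0 : (0 < e2 * e)%N by rewrite muln_gt0 e2_gt0.
have hv2v (c : k) : c != 0 -> v2 c%:A = (e2 * e)%N%:Z * v c.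
  move=> c0; have c0' : c%:A != 0 :> subvs_of K by rewrite scaler_eq0 oner_eq0 orbF.
  have -> : c%:A = vsval (c%:A : subvs_of K) by rewrite linearZ /= algid1.
  by rewrite hv2v1 // -in_algE hv1v // PoszM mulrA.
have two0L : 2%:R != 0 :> L.
  have -> : 2%:R = 2%:R%:A :> L by rewrite scaler_nat.
  by rewrite scaler_eq0 oner_eq0 orbF.
have val2L : v2 2%:R = 0.
  have -> : 2%:R = 2%:R%:A :> L by rewrite scaler_nat.
  by rewrite hv2v // val2 mulr0.
have [completeK _] := complete_nets hk hpi hv2 E_gt0 hv2v K.
have [_ netsL] := complete_nets hk hpi hv2 E_gt0 hv2v {:L}%VS.
have uK : u \notin K.
  apply/negP => /tau_id/eqP; rewrite tau_u eq_sym -addr_eq0 -mulr2n -mulr_natr.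
  by rewrite mulf_eq0 (negPf two0L) orbF (negPf hu0).
have quad := quadratic_decomposition hquad uK.
(* The exponent of [B] as an ideal of [L]; in the unramified case [pi1] is also a uniformizer of
   [L]. *)
pose m : int := if ramified then mu else ((mu + 1) %/ 2)%Z.
have BE : B = vge v2 m.
  rewrite /B /good_lattice /m; case: ifP => r2; first exact: pidealE.
  move/negbFE/eqP: r2 => /hpi2_unram <-; exact: pidealE.
have self_dual : vge v2 m = dual_lattice v pi lam (beta_form tau u) (vge v2 m).
  by rewrite -BE.
have triv := trivial_weight_space hv hpi hpsi hlam hv2 hv2v hpi2 two0 val2 two0L val2L
  completeK tauM tau_id hu0 tau_u quad self_dual.
split; last split.
- split; last by rewrite /weight BE; exact: triv.
  exists 0; rewrite BE (delta0E v2 m hpsi two0L tauM tau_id tau_u quad).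
  by rewrite asboolT ?oner_neq0 //; left.
- move=> /negbNE/eqP e21.
  have pi2E := hpi2_unram e21.
  have tpi2 : tau pi2 = pi2 by rewrite pi2E; apply: tau_id; apply: subvsP.
  have mE : m = ((mu + 1) %/ 2)%Z by rewrite /m /ramified e21.
  (* Self-duality excludes odd [mu]: then [mu + 1 = 2 m], so [D - 1 = e lam - del], and by the
     different [psi] is trivial on traces of elements of [K] of this exponent, against the choice of
     [x]. *)
  have mu2 : mu = m + m.
    have [x [xK xD px]] := psi_tr_nontrivial hv hpi hpsi hlam hv2 hv2v hpi2 two0 val2 two0L
      val2L completeK tauM tau_id hu0 tau_u quad self_dual.
    have [//|muN] := eqVneq mu (m + m); case/eqP: px; apply: hlam.1; rewrite pidealE //.
    have dimL : \dim {:L} = (2 * \dim K)%N by rewrite (dim_sup_field (subvf K)) hquad.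
    rewrite -(vsprojK xK) (ext_trace_sub quad _ dimL).
    apply: vgeMl => //; first by right; rewrite val2.
    apply: (different_trace hv hpi hv1 hpi1 he hdel).
    have [xz|x0] := eqVneq x 0; first by rewrite xz linear0; left.
    have x'0 : vsproj K x != 0.
      by apply: contraNneq x0 => x'0; rewrite -(vsprojK xK) x'0 linear0.
    apply/vgeE => //; move: xD; rewrite vgeE // -{1}(vsprojK xK) hv2v1 // e21.
    rewrite mul1r /trace_conductor; apply: le_trans.
    have : mu + 1 = m + m by lia.
    by rewrite /mu; lia.
  have [b1 b2] := unramified_weights hv hpi hpsi hlam hv2 hv2v hpi2 two0 val2 two0L val2L
    completeK netsL tauM tau_id hu0 tau_u quad self_dual tpi2.
  have mu_half : (mu %/ 2)%Z = m by rewrite mu2; lia.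
  by rewrite BE mu_half mu2 -pi2E; split.
move=> r2; have e2N : e2 <> 1%N by apply/eqP.
have mE : m = mu by rewrite /m r2.
have tpi2 : tau pi2 = - pi2 by rewrite -(hu_ram e2N).
have := ramified_weights hv hpi hpsi hlam hv2 hv2v hpi2 two0 val2 two0L val2L
  completeK netsL tauM tau_id hu0 tau_u quad self_dual tpi2 (hu_ram e2N) (hpi2_ram e2N).
by rewrite -BE mE.
Qed.
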